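(* Assume (C1) and (C2). Then problem (P) has a solution $\bar u\in\mathcal{N}$ (a critical point of $I$ on $\mathcal{D}$) such that $$I(\bar u)=\inf_{u\in\mathcal{N}}I(u)=:c_*>0.$$ In addition, $m_*\ge 2c_*$, where $m_*:=\inf_{u\in\mathcal{M}}I(u)$.
   Context: Fix real numbers $p,q,r$ with $1<p<q$, $\frac{p}{2}$ a positive integer, and $r\ge 1$, and functions $a,b,c:\mathbb{Z}\to(0,+\infty)$. Conditions: - (C1) There is $b_0>0$ with $b(n)\ge b_0$ for all $n\in\mathbb{Z}$ and $\lim_{|n|\to\infty}b(n)=+\infty$. - (C2) There is $c_0>0$ with $c(n)\le c_0$ for all $n\in\mathbb{Z}$ and $\sum_{n\in\mathbb{Z}}c(n)<+\infty$. Notation for a real sequence $u=(u(n))_{n\in\mathbb{Z}}$: $\Delta u(n)=u(n+1)-u(n)$, $u^+(n)=\max\{u(n),0\}$, $u^-(n)=\min\{u(n),0\}$, and $\varphi_p(s)=|s|^{p-2}s$. Spaces: - $E$ is the set of real sequences $u$ with $\|u\|:=\big(\sum_{n\in\mathbb{Z}}[a(n)|\Delta u(n)|^p+b(n)|u(n)|^p]\big)^{1/p}<\infty$. - $\mathcal{D}=\{u\in E:\sum_{n\in\mathbb{Z}}c(n)|u(n)|^q\ln|u(n)|^r<+\infty\}$, where terms with $u(n)=0$ are read as $0$. It carries the norm $\|\cdot\|$. For $u,v\in\mathcal{D}$: - $I(u)=\frac1p\|u\|^p+\frac{r}{q^2}\sum_{n}c(n)|u(n)|^q-\frac1q\sum_{n}c(n)|u(n)|^q\ln|u(n)|^r$.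 - $\langle I'(u),v\rangle=\sum_n\big[a(n)|\Delta u(n)|^{p-2}\Delta u(n)\Delta v(n)+b(n)|u(n)|^{p-2}u(n)v(n)\big]-\sum_n c(n)|u(n)|^{q-2}u(n)v(n)\ln|u(n)|^r$. Sets: - $\mathcal{N}=\{u\in\mathcal{D}:u\neq0,\ \langle I'(u),u\rangle=0\}$. - $\mathcal{M}=\{u\in\mathcal{D}:u^+\ne0,\ u^-\neq0,\ \langle I'(u),u^+\rangle=0,\ \langle I'(u),u^-\rangle=0\}$. Problem (P) is $$-\Delta\big(a(n-1)\varphi_p(\Delta u(n-1))\big)+b(n)\varphi_p(u(n))=c(n)|u(n)|^{q-2}u(n)\ln|u(n)|^r,\quad n\in\mathbb{Z},$$ together with $\lim_{|n|\to\infty}u(n)=0$. A solution of (P) means a critical point of $I$ in $\mathcal{D}$, i.e. $u\in\mathcal{D}$ with $\langle I'(u),v\rangle=0$ for all $v\in\mathcal{D}$. *)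

(* Defs.v *)
From Stdlib Require Import Reals ZArith.
From Coquelicot Require Import Coquelicot.
Open Scope R_scope.

Definition ex_seriesZ (f : Z -> R) : Prop :=
  ex_series (fun n : nat => f (Z.of_nat n)) /\
  ex_series (fun n : nat => f (- Z.of_nat n - 1)%Z).

Definition sumZ (f : Z -> R) : R :=
  Series (fun n : nat => f (Z.of_nat n)) + Series (fun n : nat => f (- Z.of_nat n - 1)%Z).

(* pw x y = x^y for x > 0, and 0 for x <= 0 (used with x = |s|). *)
Definition pw (x y : R) : R := if Rle_dec x 0 then 0 else Rpower x y.

Definition Dlt (u : Z -> R) (n : Z) : R := u (n + 1)%Z - u n.
Definition posp (u : Z -> R) (n : Z) : R := Rmax (u n) 0.
Definition negp (u : Z -> R) (n : Z) : R := Rmin (u n) 0.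

Definition phi (p s : R) : R := pw (Rabs s) (p - 2) * s.

Definition normterm (p : R) (a b : Z -> R) (u : Z -> R) (n : Z) : R :=
  a n * pw (Rabs (Dlt u n)) p + b n * pw (Rabs (u n)) p.

Definition inE (p : R) (a b : Z -> R) (u : Z -> R) : Prop :=
  ex_seriesZ (normterm p a b u).

Definition normp (p : R) (a b : Z -> R) (u : Z -> R) : R :=
  sumZ (normterm p a b u).

Definition logterm (q r : R) (c : Z -> R) (u : Z -> R) (n : Z) : R :=
  if Req_EM_T (u n) 0 then 0
  else c n * pw (Rabs (u n)) q * ln (Rpower (Rabs (u n)) r).

Definition inD (p q r : R) (a b c : Z -> R) (u : Z -> R) : Prop :=
  inE p a b u /\ ex_seriesZ (fun n => Rabs (logterm q r c u n)).

Definition Ifun (p q r : R) (a b c : Z -> R) (u : Z -> R) : R :=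
  / p * normp p a b u
  + r / (q ^ 2) * sumZ (fun n => c n * pw (Rabs (u n)) q)
  - / q * sumZ (logterm q r c u).

Definition dI (p q r : R) (a b c : Z -> R) (u v : Z -> R) : R :=
  sumZ (fun n => a n * phi p (Dlt u n) * Dlt v n + b n * phi p (u n) * v n)
  - sumZ (fun n => if Req_EM_T (u n) 0 then 0
                   else c n * pw (Rabs (u n)) (q - 2) * u n * v n
                        * ln (Rpower (Rabs (u n)) r)).

Definition nonzero (u : Z -> R) : Prop := exists n, u n <> 0.

Definition inN (p q r : R) (a b c : Z -> R) (u : Z -> R) : Prop :=
  inD p q r a b c u /\ nonzero u /\ dI p q r a b c u u = 0.

Definition inM (p q r : R) (a b c : Z -> R) (u : Z -> R) : Prop :=
  inD p q r a b c u /\ nonzero (posp u) /\ nonzero (negp u) /\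
  dI p q r a b c u (posp u) = 0 /\ dI p q r a b c u (negp u) = 0.

Definition critical (p q r : R) (a b c : Z -> R) (u : Z -> R) : Prop :=
  inD p q r a b c u /\
  forall v, inD p q r a b c v -> dI p q r a b c u v = 0.

(* Main.v *)
Require Import Defs.
From Stdlib Require Import Reals ZArith Lra Lia ClassicalEpsilon.
From Coquelicot Require Import Coquelicot.
Open Scope R_scope.

(* Write N = ||u||^p, A = sum c |u|^q, L = sum c |u|^q ln |u|^r. Elements of E
   are bounded, so (C2) gives D = E and makes A and L continuous along bounded
   pointwise convergent sequences, while N is lower semicontinuous (Fatou).

   Along a ray, <I'(e^y u), e^y u> = e^(q y) (N e^(-(q-p) y) - L - r A y), which
   vanishes for exactly one y; I restricted to the ray is maximal there, and
   y <= 0 if N <= L. On the Nehari set N = L, so I = (1/p - 1/q) N + (r/q^2) A,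
   and |u(n)| > 1 for some n, so N >= b0 there.

   A minimizing sequence is bounded, hence has a pointwise limit l with
   L(l) >= b0 > 0 and N(l) <= L(l); dilating l back to the Nehari set decreases
   (1/p - 1/q) N + (r/q^2) A, so a minimizer exists. It is critical because
   I(t u) <= I(u) <= I(t (u + s v)) whenever t (u + s v) lies in the Nehari set,
   which happens for s -> 0 with t -> 1.

   For a sign-changing u in M, N(u^+) - L(u^+) <= <I'(u), u^+> = 0, so u^+ and
   u^- can both be dilated down to the Nehari set, and the energies add up. *)

Lemma choice {A B : Type} (P : A -> B -> Prop) :
  (forall x, exists y, P x y) -> exists f, forall x, P x (f x).
Proof.
  intros H. exists (fun x => proj1_sig (constructive_indefinite_description _ (H x))).
  intros x. apply proj2_sig.
Qed.

(** * Series over the integers *)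

(** The terms may have any sign: the comparison for nonnegative series is applied to [g - f], and
    linearity does the rest. *)
Lemma Series_le_of_ex (f g : nat -> R) :
  (forall n, f n <= g n) -> ex_series f -> ex_series g -> Series f <= Series g.
Proof.
  intros Hle Hf Hg.
  assert (H : Series (fun _ : nat => 0) <= Series (fun n => g n - f n)).
  { apply Series_le.
    - intros n. specialize (Hle n). lra.
    - exact (ex_series_minus g f Hg Hf). }
  rewrite (Series_minus g f Hg Hf) in H.
  rewrite (Series_ext _ (fun n => 0 * 0)) in H by (intros; lra).
  rewrite Series_scal_l in H. lra.
Qed.

Lemma Series_nonneg (f : nat -> R) :
  (forall n, 0 <= f n) -> ex_series f -> 0 <= Series f.
Proof.
  intros H0 Hf.
  assert (H := Series_le (fun _ => 0 * 0) f).
  rewrite Series_scal_l in H.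
  enough (0 * Series (fun _ : nat => 0) <= Series f) by lra.
  apply H; [intros n; specialize (H0 n); lra | assumption].
Qed.

Lemma sum_n_le_Series (f : nat -> R) (N : nat) :
  (forall n, 0 <= f n) -> ex_series f -> sum_n f N <= Series f.
Proof.
  intros H0 Hf.
  apply (is_lim_seq_incr_compare (sum_n f)).
  - exact (Series_correct f Hf).
  - intros n. rewrite sum_Sn. unfold plus; simpl. specialize (H0 (S n)). lra.
Qed.

Lemma term_le_Series (f : nat -> R) (n : nat) :
  (forall n, 0 <= f n) -> ex_series f -> f n <= Series f.
Proof.
  intros H0 Hf. apply Rle_trans with (2 := sum_n_le_Series f n H0 Hf).
  destruct n as [|n].
  - rewrite sum_O. lra.
  - rewrite sum_Sn. unfold plus; simpl.
    enough (0 <= sum_n f n) by lra.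
    clear - H0. induction n as [|n IH].
    + rewrite sum_O. apply H0.
    + rewrite sum_Sn. unfold plus; simpl. specialize (H0 (S n)). lra.
Qed.

Lemma is_lim_seq_sum_n (f : nat -> nat -> R) (l : nat -> R) (N : nat) :
  (forall n, is_lim_seq (fun k => f k n) (l n)) ->
  is_lim_seq (fun k => sum_n (f k) N) (sum_n l N).
Proof.
  intros H. induction N as [|N IH].
  - rewrite sum_O. apply is_lim_seq_ext with (2 := H O).
    intros k. now rewrite sum_O.
  - rewrite sum_Sn.
    apply is_lim_seq_ext with (u := fun k => sum_n (f k) N + f k (S N)).
    + intros k. now rewrite sum_Sn.
    + apply (is_lim_seq_plus' _ _ _ _ IH (H (S N))).
Qed.

(** Each finite partial sum passes to the limit termwise and stays below [s]; the partial sums of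
    [l] are nondecreasing, hence converge. *)
Lemma Series_fatou (f : nat -> nat -> R) (l : nat -> R) (S : nat -> R) (s : R) :
  (forall k n, 0 <= f k n) -> (forall k, ex_series (f k)) ->
  (forall n, is_lim_seq (fun k => f k n) (l n)) ->
  (forall k, Series (f k) <= S k) -> is_lim_seq S s ->
  ex_series l /\ Series l <= s.
Proof.
  intros H0 Hex Hl HS Hs.
  assert (Hl0 : forall n, 0 <= l n).
  { intros n. apply (is_lim_seq_le (fun _ => 0) (fun k => f k n) 0 (l n)).
    - intros k; apply H0.
    - apply is_lim_seq_const.
    - apply Hl. }
  assert (Hb : forall N, sum_n l N <= s).
  { intros N.
    apply (is_lim_seq_le (fun k => sum_n (f k) N) S (sum_n l N) s).
    - intros k. apply Rle_trans with (2 := HS k). now apply sum_n_le_Series.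
    - now apply is_lim_seq_sum_n.
    - assumption. }
  assert (Hinc : forall N, sum_n l N <= sum_n l (Datatypes.S N)).
  { intros N. rewrite sum_Sn. unfold plus; simpl.
    specialize (Hl0 (Datatypes.S N)). lra. }
  assert (Hex' : ex_series l).
  { destruct (ex_finite_lim_seq_incr (sum_n l) s Hinc Hb) as [x Hx].
    exists x. exact Hx. }
  split; [assumption|].
  apply (is_lim_seq_le (sum_n l) (fun _ => s) (Series l) s).
  - assumption.
  - exact (Series_correct l Hex').
  - apply is_lim_seq_const.
Qed.

Lemma ex_series_of_le (f g : nat -> R) :
  (forall n, Rabs (f n) <= g n) -> ex_series g -> ex_series f.
Proof. intros H Hg. exact (ex_series_le f g H Hg). Qed.

(** Domination by [2 * M] controls the tail of the deviations uniformly in [k]; the finitely many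
    remaining terms tend to 0. *)
Lemma Series_dominated (f : nat -> nat -> R) (l M : nat -> R) :
  (forall k n, Rabs (f k n) <= M n) -> ex_series M ->
  (forall n, is_lim_seq (fun k => f k n) (l n)) ->
  is_lim_seq (fun k => Series (f k)) (Series l).
Proof.
  intros HM HexM Hl.
  assert (HlM : forall n, Rabs (l n) <= M n).
  { intros n.
    apply (is_lim_seq_le (fun k => Rabs (f k n)) (fun _ => M n) (Rabs (l n)) (M n)).
    - intros k; apply HM.
    - apply (is_lim_seq_abs _ (l n)), Hl.
    - apply is_lim_seq_const. }
  assert (Hf : forall k, ex_series (f k)).
  { intros k. apply ex_series_of_le with M; auto. }
  assert (Hexl : ex_series l) by (apply ex_series_of_le with M; auto).
  set (g k n := Rabs (f k n - l n)).
  assert (Hg0 : forall k n, 0 <= g k n) by (intros; apply Rabs_pos).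
  assert (HgM : forall k n, g k n <= 2 * M n).
  { intros k n. unfold g.
    eapply Rle_trans; [apply Rabs_triang|]. rewrite Rabs_Ropp.
    specialize (HM k n). specialize (HlM n). lra. }
  assert (Hex2M : ex_series (fun n => 2 * M n)) 
    by exact (ex_series_scal_l 2 M HexM).
  assert (Hgex : forall k, ex_series (g k)).
  { intros k. apply ex_series_of_le with (2 := Hex2M).
    intros n. rewrite Rabs_pos_eq; auto. }
  apply is_lim_seq_spec. intros eps.
  destruct (proj2 (is_lim_seq_spec (sum_n (fun n => 2 * M n)) (Series (fun n => 2 * M n)))
              (Series_correct _ Hex2M)
              (mkposreal (eps / 2) ltac:(destruct eps; simpl; lra))) as [N HN].
  specialize (HN N (le_n N)). cbn [pos] in HN.
  assert (Hsum : is_lim_seq (fun k => sum_n (g k) N) (sum_n (fun _ => 0) N)).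
  { apply is_lim_seq_sum_n. intros n. unfold g.
    replace (Finite 0) with (Rbar_abs 0) by (simpl; now rewrite Rabs_R0).
    apply is_lim_seq_abs.
    replace 0 with (l n - l n) by lra.
    apply is_lim_seq_minus'; [apply Hl | apply is_lim_seq_const]. }
  assert (Hz : sum_n (fun _ => 0) N = 0).
  { clear. induction N as [|N IH]; [now rewrite sum_O|].
    rewrite sum_Sn, IH. unfold plus; simpl. lra. }
  rewrite Hz in Hsum.
  destruct (proj2 (is_lim_seq_spec _ _) Hsum
              (mkposreal (eps / 2) ltac:(destruct eps; simpl; lra))) as [K HK].
  exists K. intros k Hk. specialize (HK k Hk). cbn [pos] in HK.
  rewrite <- Series_minus by auto.
  eapply Rle_lt_trans; [apply Series_Rabs, (Hgex k)|].
  change (Series (g k) < eps).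
  (* Splitting both series after index [N] reduces the tail estimate to the termwise bound
     [g k n <= 2 * M n]. *)
  assert (Htail : Series (g k) - sum_n (g k) N
                  <= Series (fun n => 2 * M n) - sum_n (fun n => 2 * M n) N).
  { rewrite (Series_incr_n (g k) (S N)) by (auto; lia).
    rewrite (Series_incr_n (fun n => 2 * M n) (S N)) by (auto; lia).
    rewrite !sum_n_Reals. simpl Nat.pred.
    enough (Series (fun i => g k (S N + i)%nat) <= Series (fun i => 2 * M (S N + i)%nat)) by lra.
    apply Series_le.
    - intros i; split; auto.
    - apply (ex_series_incr_n (fun n => 2 * M n) (S N)), Hex2M. }
  apply Rabs_lt_between in HN. apply Rabs_lt_between in HK. lra.
Qed.

Lemma ex_seriesZ_le (f g : Z -> R) :
  (forall n, Rabs (f n) <= g n) -> ex_seriesZ g -> ex_seriesZ f.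
Proof.
  intros H [H1 H2]. split.
  - apply ex_series_of_le with (2 := H1). intros n; apply H.
  - apply ex_series_of_le with (2 := H2). intros n; apply H.
Qed.

Lemma ex_seriesZ_ext (f g : Z -> R) :
  (forall n, f n = g n) -> ex_seriesZ f -> ex_seriesZ g.
Proof.
  intros H [H1 H2]. split.
  - apply ex_series_ext with (2 := H1). intros n; apply H.
  - apply ex_series_ext with (2 := H2). intros n; apply H.
Qed.

Lemma ex_seriesZ_plus (f g : Z -> R) :
  ex_seriesZ f -> ex_seriesZ g -> ex_seriesZ (fun n => f n + g n).
Proof.
  intros [F1 F2] [G1 G2]. split.
  - exact (ex_series_plus _ _ F1 G1).
  - exact (ex_series_plus _ _ F2 G2).
Qed.

Lemma ex_seriesZ_scal (x : R) (f : Z -> R) :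
  ex_seriesZ f -> ex_seriesZ (fun n => x * f n).
Proof.
  intros [F1 F2]. split.
  - exact (ex_series_scal_l x _ F1).
  - exact (ex_series_scal_l x _ F2).
Qed.

Lemma sumZ_ext (f g : Z -> R) : (forall n, f n = g n) -> sumZ f = sumZ g.
Proof. intros H. unfold sumZ. f_equal; apply Series_ext; intros n; apply H. Qed.

Lemma sumZ_plus (f g : Z -> R) : ex_seriesZ f -> ex_seriesZ g ->
  sumZ (fun n => f n + g n) = sumZ f + sumZ g.
Proof.
  intros [F1 F2] [G1 G2]. unfold sumZ. rewrite !Series_plus by assumption. lra.
Qed.

Lemma sumZ_scal (x : R) (f : Z -> R) : sumZ (fun n => x * f n) = x * sumZ f.
Proof. unfold sumZ. rewrite !Series_scal_l. lra. Qed.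

Lemma sumZ_minus (f g : Z -> R) : ex_seriesZ f -> ex_seriesZ g ->
  sumZ (fun n => f n - g n) = sumZ f - sumZ g.
Proof.
  intros [F1 F2] [G1 G2]. unfold sumZ. rewrite !Series_minus by assumption. lra.
Qed.

Lemma sumZ_le (f g : Z -> R) : (forall n, f n <= g n) ->
  ex_seriesZ f -> ex_seriesZ g -> sumZ f <= sumZ g.
Proof.
  intros H [F1 F2] [G1 G2]. unfold sumZ. apply Rplus_le_compat;
  apply Series_le_of_ex; auto.
Qed.

Lemma term_le_sumZ (f : Z -> R) (n : Z) :
  (forall n, 0 <= f n) -> ex_seriesZ f -> f n <= sumZ f.
Proof.
  intros H0 [F1 F2]. unfold sumZ.
  assert (P1 := Series_nonneg _ (fun n => H0 _) F1).
  assert (P2 := Series_nonneg _ (fun n => H0 _) F2).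
  destruct (Z_le_gt_dec 0 n) as [Hn|Hn].
  - assert (T := term_le_Series _ (Z.to_nat n) (fun n => H0 _) F1).
    cbv beta in T. rewrite Z2Nat.id in T by lia. lra.
  - assert (T := term_le_Series _ (Z.to_nat (- n - 1)) (fun n => H0 _) F2).
    cbv beta in T. rewrite Z2Nat.id in T by lia.
    replace (- (- n - 1) - 1)%Z with n in T by lia. lra.
Qed.

Lemma sumZ_nonneg (f : Z -> R) :
  (forall n, 0 <= f n) -> ex_seriesZ f -> 0 <= sumZ f.
Proof.
  intros H0 Hf. apply Rle_trans with (1 := H0 0%Z). now apply term_le_sumZ.
Qed.

Lemma sumZ_dominated (f : nat -> Z -> R) (l M : Z -> R) :
  (forall k n, Rabs (f k n) <= M n) -> ex_seriesZ M ->
  (forall n, is_lim_seq (fun k => f k n) (l n)) ->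
  is_lim_seq (fun k => sumZ (f k)) (sumZ l).
Proof.
  intros HM [M1 M2] Hl. unfold sumZ. apply is_lim_seq_plus'.
  - apply (Series_dominated (fun k n => f k (Z.of_nat n)) _ _ (fun k n => HM k _) M1).
    intros n; apply Hl.
  - apply (Series_dominated (fun k n => f k (- Z.of_nat n - 1)%Z) _ _ (fun k n => HM k _) M2).
    intros n; apply Hl.
Qed.

Lemma ex_seriesZ_finite (f : Z -> R) (N : nat) :
  (forall n, (Z.of_nat N <= Z.abs n)%Z -> f n = 0) -> ex_seriesZ f.
Proof.
  intros H. split; apply (ex_series_incr_n _ N);
    (* Past [N] all terms vanish, so a geometric series multiplied by [0] is a majorant. *)
    apply ex_series_of_le with (g := fun n => 0 * (1 / 2) ^ n);
    try (intros n; rewrite H by lia; rewrite Rabs_R0; lra);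
    refine (ex_series_scal_l 0 _ _); apply ex_series_geom; rewrite Rabs_pos_eq; lra.
Qed.

(** The hypothesis bounds only the sum of the two half-series, so they are folded into one series
    over [nat] before [Series_fatou] applies. *)
Lemma sumZ_fatou (f : nat -> Z -> R) (l : Z -> R) (S : nat -> R) (s : R) :
  (forall k n, 0 <= f k n) -> (forall k, ex_seriesZ (f k)) ->
  (forall n, is_lim_seq (fun k => f k n) (l n)) ->
  (forall k, sumZ (f k) <= S k) -> is_lim_seq S s ->
  ex_seriesZ l /\ sumZ l <= s.
Proof.
  intros H0 Hex Hl HS Hs.
  assert (Hl0 : forall n, 0 <= l n).
  { intros n. apply (is_lim_seq_le (fun _ => 0) (fun k => f k n) 0 (l n)).
    - intros k; apply H0.
    - apply is_lim_seq_const.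
    - apply Hl. }
  set (fold := fun (g : Z -> R) (n : nat) => g (Z.of_nat n) + g (- Z.of_nat n - 1)%Z).
  destruct (Series_fatou (fun k => fold (f k)) (fold l) S s) as [H1 H2].
  - intros k n. unfold fold. specialize (H0 k (Z.of_nat n)) as P1.
    specialize (H0 k (- Z.of_nat n - 1)%Z) as P2. lra.
  - intros k. destruct (Hex k) as [E1 E2]. exact (ex_series_plus _ _ E1 E2).
  - intros n. apply is_lim_seq_plus'; apply Hl.
  - intros k. destruct (Hex k) as [E1 E2]. unfold fold.
    rewrite Series_plus by assumption. apply HS.
  - assumption.
  - assert (Hexl : ex_seriesZ l).
    { split; apply ex_series_of_le with (2 := H1); intros n; unfold fold;
        rewrite Rabs_pos_eq by apply Hl0;
        specialize (Hl0 (Z.of_nat n)) as P1;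
        specialize (Hl0 (- Z.of_nat n - 1)%Z) as P2; lra. }
    split; [assumption|].
    destruct Hexl as [E1 E2]. unfold sumZ. rewrite <- Series_plus by assumption.
    exact H2.
Qed.

(** * Powers and logarithms *)

Lemma pw_0 (y : R) : pw 0 y = 0.
Proof. unfold pw. destruct (Rle_dec 0 0); lra. Qed.

Lemma pw_pos (x y : R) : 0 < x -> pw x y = exp (y * ln x).
Proof. intros H. unfold pw. destruct (Rle_dec x 0); [lra | reflexivity]. Qed.

Lemma pw_nonneg (x y : R) : 0 <= pw x y.
Proof. unfold pw. destruct (Rle_dec x 0); [lra | left; apply exp_pos]. Qed.

Lemma pw_exp_scale (s x y : R) :
  pw (Rabs (exp s * x)) y = exp (y * s) * pw (Rabs x) y.
Proof.
  rewrite Rabs_mult, (Rabs_pos_eq (exp s)) by (left; apply exp_pos).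
  destruct (Req_dec x 0) as [->|Hx].
  - rewrite Rabs_R0, Rmult_0_r, pw_0. lra.
  - assert (H := Rabs_pos_lt x Hx). assert (He := exp_pos s).
    rewrite !pw_pos by nra. rewrite ln_mult, ln_exp by assumption.
    rewrite <- exp_plus. f_equal. lra.
Qed.

Lemma locally_neq0 (x : R) : x <> 0 -> locally x (fun z : R => z <> 0).
Proof.
  intros Hx. exists (mkposreal (Rabs x) (Rabs_pos_lt x Hx)).
  intros z Hz Hz0. subst z.
  unfold ball, AbsRing_ball in Hz; simpl in Hz.
  unfold AbsRing_ball, abs, minus, plus, opp in Hz; simpl in Hz.
  rewrite Rplus_0_l, Rabs_Ropp in Hz. lra.
Qed.

Lemma continuity_pt_pw_abs (y x : R) :
  0 < y -> continuity_pt (fun x => pw (Rabs x) y) x.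
Proof.
  intros Hy. destruct (Req_dec x 0) as [->|Hx].
  - apply continuity_pt_locally. intros eps.
    assert (He := cond_pos eps).
    (* The radius is [eps^(1/y)], the solution of [x^y = eps]. *)
    exists (mkposreal (exp (ln eps / y)) (exp_pos _)).
    intros z Hz. change (Rabs (z - 0) < exp (ln eps / y)) in Hz.
    rewrite Rminus_0_r in Hz.
    rewrite Rabs_R0, pw_0, Rminus_0_r, Rabs_pos_eq by apply pw_nonneg.
    destruct (Req_dec z 0) as [->|Hz0].
    { now rewrite Rabs_R0, pw_0. }
    assert (H := Rabs_pos_lt z Hz0). rewrite pw_pos by assumption.
    rewrite <- (exp_ln eps) by assumption. apply exp_increasing.
    apply (ln_increasing _ _ H) in Hz. rewrite ln_exp in Hz.
    apply Rmult_lt_compat_l with (1 := Hy) in Hz.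
    replace (y * (ln eps / y)) with (ln eps) in Hz by (field; lra). exact Hz.
  - apply continuity_pt_ext_loc with (f := fun z => exp (y * ln (Rabs z))).
    + generalize (locally_neq0 x Hx). apply filter_imp. intros z Hz.
      now rewrite pw_pos by now apply Rabs_pos_lt.
    + apply continuity_pt_filterlim.
      apply (ex_derive_continuous (fun z => exp (y * ln (Rabs z)))).
      auto_derive. split; [assumption|split; [now apply Rabs_pos_lt|exact I]].
Qed.

(* [powlog y 0 = 0] because [pw 0 y = 0]. *)
Definition powlog (y x : R) : R := pw (Rabs x) y * ln (Rabs x).

Lemma powlog_0 (y : R) : powlog y 0 = 0.
Proof. unfold powlog. rewrite Rabs_R0, pw_0. lra. Qed.

Lemma powlog_exp_scale (s x y : R) :
  powlog y (exp s * x) = exp (y * s) * (powlog y x + s * pw (Rabs x) y).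
Proof.
  unfold powlog. rewrite pw_exp_scale.
  destruct (Req_dec x 0) as [->|Hx].
  - rewrite Rabs_R0, pw_0. lra.
  - rewrite Rabs_mult, (Rabs_pos_eq (exp s)) by (left; apply exp_pos).
    rewrite ln_mult, ln_exp; [lra | apply exp_pos | now apply Rabs_pos_lt].
Qed.

(** Half of the power absorbs the logarithm: with [t = - (y / 2) * ln |x| >= 0],
    [exp (- t) * t <= 1], and the other half [|x|^(y/2)] remains. *)
Lemma powlog_near_0 (y x : R) :
  0 < y -> Rabs x <= 1 -> Rabs (powlog y x) <= 2 / y * pw (Rabs x) (y / 2).
Proof.
  intros Hy Hx1. destruct (Req_dec x 0) as [->|Hx].
  - rewrite powlog_0, !Rabs_R0, pw_0. lra.
  - assert (H := Rabs_pos_lt x Hx). unfold powlog. rewrite !pw_pos by assumption.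
    set (l := ln (Rabs x)).
    assert (Hl : l <= 0).
    { unfold l. rewrite <- ln_1. apply ln_le; lra. }
    rewrite Rabs_mult, Rabs_pos_eq by (left; apply exp_pos).
    rewrite Rabs_left1 by assumption.
    replace (y * l) with (y / 2 * l + y / 2 * l) by lra.
    rewrite exp_plus. set (e := exp (y / 2 * l)).
    assert (He : 0 < e) by apply exp_pos.
    assert (Hb : e * (1 + - (y / 2 * l)) <= 1).
    { unfold e. apply Rmult_le_reg_l with (exp (- (y / 2 * l))).
      - apply exp_pos.
      - rewrite <- Rmult_assoc, <- exp_plus, Rplus_opp_l, exp_0, Rmult_1_l, Rmult_1_r.
        apply exp_ineq1_le. }
    apply Rmult_le_reg_l with (y / 2); [lra|].
    replace (y / 2 * (2 / y * e)) with e by (field; lra). nra.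
Qed.

Lemma continuity_pt_powlog (y x : R) : 0 < y -> continuity_pt (powlog y) x.
Proof.
  intros Hy. destruct (Req_dec x 0) as [->|Hx].
  - apply continuity_pt_locally. intros eps.
    assert (Hc := continuity_pt_pw_abs (y / 2) 0 ltac:(lra)).
    assert (He := cond_pos eps).
    assert (He' : 0 < y / 2 * eps) by nra.
    assert (H1 := proj1 (continuity_pt_locally _ _) Hc (mkposreal _ He')).
    assert (H2 : locally 0 (fun z : R => Rabs z <= 1)).
    { exists (mkposreal 1 Rlt_0_1). intros z Hz. change (Rabs (z - 0) < 1) in Hz.
      rewrite Rminus_0_r in Hz. lra. }
    generalize (filter_and _ _ H1 H2). apply filter_imp. intros z [Hz1 Hz2].
    cbn [pos] in Hz1. rewrite Rabs_R0, pw_0, Rminus_0_r in Hz1.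
    rewrite Rabs_pos_eq in Hz1 by apply pw_nonneg.
    rewrite powlog_0, Rminus_0_r.
    eapply Rle_lt_trans; [now apply powlog_near_0|].
    apply Rmult_lt_compat_l with (r := 2 / y) in Hz1.
    + replace (2 / y * (y / 2 * eps)) with (pos eps) in Hz1 by (field; lra). exact Hz1.
    + apply Rdiv_lt_0_compat; lra.
  - apply (continuity_pt_mult (fun z => pw (Rabs z) y) (fun z => ln (Rabs z))).
    + now apply continuity_pt_pw_abs.
    + apply continuity_pt_filterlim.
      apply (ex_derive_continuous (fun z => ln (Rabs z))).
      auto_derive. split; [assumption|split; [now apply Rabs_pos_lt|exact I]].
Qed.

(** Valid at [x = 0] for every exponent, because [pw] vanishes there; it turns [|x|^(q-2) x] paired
    with [x] into [|x|^q]. *)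
Lemma pw_abs_square (y x : R) : pw (Rabs x) y = pw (Rabs x) (y - 2) * (x * x).
Proof.
  destruct (Req_dec x 0) as [->|Hx].
  - rewrite Rabs_R0, !pw_0. lra.
  - assert (H := Rabs_pos_lt x Hx). rewrite !pw_pos by assumption.
    replace (x * x) with (Rabs x * Rabs x) by (rewrite <- Rabs_mult; apply Rabs_pos_eq, Rle_0_sqr).
    rewrite <- (exp_ln (Rabs x)) at 3 4 by assumption.
    rewrite <- !exp_plus. f_equal. lra.
Qed.

Lemma is_derive_ln_abs (x : R) : x <> 0 -> is_derive (fun z => ln (Rabs z)) x (/ x).
Proof.
  intros Hx. auto_derive.
  - split; [assumption|split; [now apply Rabs_pos_lt|exact I]].
  - destruct (Rlt_or_le x 0) as [H|H].
    + rewrite sign_eq_m1, Rabs_left by lra. field; lra.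
    + rewrite sign_eq_1, Rabs_pos_eq by lra. field; lra.
Qed.

(* [I u = 1/p ||u||^p + sum_n c(n) logpot q r (u n)]. *)
Definition logpot (q r x : R) : R := r / q ^ 2 * pw (Rabs x) q - r / q * powlog q x.

(** The factored form gives the derivative at 0, where [ln |x|] is singular: for [q > 2] the inner
    factor is continuous. *)
Lemma logpot_square (q r x : R) :
  logpot q r x = x * (x * (r / q ^ 2 * pw (Rabs x) (q - 2) - r / q * powlog (q - 2) x)).
Proof.
  unfold logpot, powlog. rewrite (pw_abs_square q x). lra.
Qed.

(** The difference quotient at 0 is [g] itself, so continuity of [g] is enough. *)
Lemma is_derive_0_of_factor (f g : R -> R) :
  (forall x, f x = x * g x) -> continuity_pt g 0 -> is_derive f 0 (g 0).
Proof.
  intros Hf Hg. apply is_derive_Reals. intros eps Heps.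
  destruct (proj1 (continuity_pt_locally g 0) Hg (mkposreal eps Heps)) as [d Hd].
  exists d. intros h Hh Hhd.
  rewrite !Hf, Rplus_0_l.
  replace ((h * g h - 0 * g 0) / h) with (g h) by (field; assumption).
  apply Hd. change (Rabs (h - 0) < d). now rewrite Rminus_0_r.
Qed.

(** The coefficients [r / q ^ 2] and [r / q] are matched so that the pure power terms of the
    derivative cancel and only the logarithmic one survives. Away from 0 the substitution
    [s = ln |x|] reduces this to exponentials. *)
Lemma is_derive_logpot (q r x : R) : 2 < q ->
  is_derive (logpot q r) x (- r * (powlog (q - 2) x * x)).
Proof.
  intros Hq. destruct (Req_dec x 0) as [->|Hx].
  - rewrite Rmult_0_r, Rmult_0_r.
    set (g := fun x => r / q ^ 2 * pw (Rabs x) (q - 2) - r / q * powlog (q - 2) x).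
    replace 0 with (0 * g 0) at 2 by lra.
    apply (is_derive_0_of_factor _ (fun x => x * g x)).
    + apply logpot_square.
    + apply continuity_pt_mult; [apply continuity_pt_id|].
      apply continuity_pt_minus; apply continuity_pt_scal.
      * apply continuity_pt_pw_abs. lra.
      * apply continuity_pt_powlog. lra.
  - set (F := fun s => r / q ^ 2 * exp (q * s) - r / q * (exp (q * s) * s)).
    apply is_derive_ext_loc with (f := fun z => F (ln (Rabs z))).
    + generalize (locally_neq0 x Hx). apply filter_imp. intros z Hz.
      unfold F, logpot, powlog. now rewrite pw_pos by now apply Rabs_pos_lt.
    + assert (HF : is_derive F (ln (Rabs x)) (- r * (exp (q * ln (Rabs x)) * ln (Rabs x)))).
      { unfold F. auto_derive; [exact I|]. field. lra. }
      assert (HC := is_derive_comp F (fun z => ln (Rabs z)) x _ _ HF (is_derive_ln_abs x Hx)).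
      replace (- r * (powlog (q - 2) x * x))
        with (scal (/ x) (- r * (exp (q * ln (Rabs x)) * ln (Rabs x)))).
      * exact HC.
      * unfold scal; simpl; unfold mult; simpl. unfold powlog.
        rewrite <- pw_pos by now apply Rabs_pos_lt.
        rewrite (pw_abs_square q x). field. assumption.
Qed.

(** * Boundedness, mean values and difference quotients *)

Lemma continuity_pt_bounded (f : R -> R) (B : R) :
  (forall x, continuity_pt f x) ->
  exists C, 0 <= C /\ forall x, Rabs x <= B -> Rabs (f x) <= C.
Proof.
  intros Hf. destruct (Rle_lt_dec 0 B) as [HB|HB].
  - destruct (continuity_ab_maj (fun x => Rabs (f x)) (- B) B ltac:(lra)) as [M [HM _]].
    + intros x _. apply (continuity_pt_comp f Rabs); [apply Hf | apply Rcontinuity_abs].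
    + exists (Rabs (f M)). split; [apply Rabs_pos|].
      intros x Hx. apply HM. now apply Rabs_le_between.
  - exists 0. split; [lra|]. intros x Hx. assert (H := Rabs_pos x). lra.
Qed.

Lemma increment_mean_value (f f' : R -> R) (x h : R) :
  (forall x, is_derive f x (f' x)) ->
  exists xi, f (x + h) - f x = f' xi * h /\ Rabs (xi - x) <= Rabs h.
Proof.
  intros Hf. destruct (MVT_cor4 f f' x (Rabs h) (fun c _ => Hf c) (x + h)) as [xi Hxi].
  - replace (x + h - x) with h by lra. lra.
  - exists xi. now replace (x + h - x) with h in Hxi by lra.
Qed.

(** The base points [x k] and directions [y k] both move; the mean value points are squeezed towards
    [x0], where [f'] is continuous. *)
Lemma is_lim_seq_difference_quotient (f f' : R -> R) (x y s : nat -> R) (x0 y0 : R) :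
  (forall x, is_derive f x (f' x)) -> continuity_pt f' x0 ->
  is_lim_seq x x0 -> is_lim_seq y y0 -> is_lim_seq s 0 -> (forall k, s k <> 0) ->
  is_lim_seq (fun k => (f (x k + s k * y k) - f (x k)) / s k) (f' x0 * y0).
Proof.
  intros Hf Hc Hx Hy Hs Hs0.
  destruct (choice (fun k xi => f (x k + s k * y k) - f (x k) = f' xi * (s k * y k)
                                /\ Rabs (xi - x k) <= Rabs (s k * y k))) as [xi Hxi].
  { intros k. now apply increment_mean_value. }
  assert (Hsy : is_lim_seq (fun k => Rabs (s k * y k)) 0).
  { replace (Finite 0) with (Rbar_abs (0 * y0)) by (simpl; now rewrite Rmult_0_l, Rabs_R0).
    apply is_lim_seq_abs. now apply is_lim_seq_mult'. }
  assert (Hd : is_lim_seq (fun k => xi k - x k) 0).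
  { apply is_lim_seq_abs_0.
    apply is_lim_seq_le_le with (u := fun _ => 0) (w := fun k => Rabs (s k * y k)).
    - intros k. split; [apply Rabs_pos | apply Hxi].
    - apply is_lim_seq_const.
    - assumption. }
  assert (Hxi0 : is_lim_seq xi x0).
  { apply is_lim_seq_ext with (u := fun k => (xi k - x k) + x k); [intros; lra|].
    replace x0 with (0 + x0) by lra. now apply is_lim_seq_plus'. }
  apply is_lim_seq_ext with (u := fun k => f' (xi k) * y k).
  - intros k. rewrite (proj1 (Hxi k)). field. apply Hs0.
  - apply is_lim_seq_mult'; [|assumption]. now apply is_lim_seq_continuous.
Qed.

(** * Even integer powers and elementary inequalities *)

Lemma pow_even_succ (x : R) (j : nat) : x ^ (2 * j + 2) = x * x ^ (2 * j + 1).
Proof. now replace (2 * j + 2)%nat with (S (2 * j + 1)) by lia. Qed.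

Lemma sqr_pow_nonneg (x : R) (j : nat) : 0 <= x ^ (2 * j + 2).
Proof.
  replace (2 * j + 2)%nat with (2 * S j)%nat by lia. rewrite pow_mult.
  apply pow_le, pow2_ge_0.
Qed.

Lemma pow_abs_even (x : R) (j : nat) : Rabs x ^ (2 * j + 2) = x ^ (2 * j + 2).
Proof. rewrite RPow_abs. apply Rabs_pos_eq, sqr_pow_nonneg. Qed.

(** For an even integer exponent the real power is a polynomial, so the absolute values disappear
    from the norm terms. *)
Lemma pw_abs_even (x : R) (j : nat) : pw (Rabs x) (INR (2 * j + 2)) = x ^ (2 * j + 2).
Proof.
  rewrite <- pow_abs_even. destruct (Req_dec x 0) as [->|Hx].
  - rewrite Rabs_R0, pw_0. rewrite pow_i by lia. reflexivity.
  - assert (H := Rabs_pos_lt x Hx). rewrite <- Rpower_pow by assumption.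
    now apply pw_pos.
Qed.

Lemma phi_even (x : R) (j : nat) : phi (INR (2 * j + 2)) x = x ^ (2 * j + 1).
Proof.
  unfold phi. destruct (Req_dec x 0) as [->|Hx].
  - rewrite pow_i by lia. lra.
  - assert (H : pw (Rabs x) (INR (2 * j + 2) - 2) * (x * x) = x ^ (2 * j + 1) * x).
    { rewrite <- pw_abs_square, pw_abs_even.
      replace (2 * j + 2)%nat with (S (2 * j + 1)) by lia. simpl. lra. }
    apply Rmult_eq_reg_r with x; [|assumption]. lra.
Qed.

(** The larger of [|x|] and [|y|] replaces the smaller one, and the product becomes a single
    power. *)
Lemma young_pow (x y : R) (m : nat) :
  Rabs x ^ m * Rabs y <= Rabs x ^ S m + Rabs y ^ S m.
Proof.
  assert (Hx := Rabs_pos x). assert (Hy := Rabs_pos y).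
  assert (Px := pow_le _ m Hx). assert (Py := pow_le _ m Hy). simpl.
  destruct (Rle_lt_dec (Rabs x) (Rabs y)) as [H|H].
  - assert (P := pow_incr (Rabs x) (Rabs y) m ltac:(lra)). nra.
  - nra.
Qed.

Lemma pow_sum_le (x y : R) (m : nat) :
  (Rabs x + Rabs y) ^ m <= 2 ^ m * (Rabs x ^ m + Rabs y ^ m).
Proof.
  assert (Hx := Rabs_pos x). assert (Hy := Rabs_pos y).
  assert (Px := pow_le _ m Hx). assert (Py := pow_le _ m Hy).
  assert (P2 := pow_le 2 m ltac:(lra)).
  assert (H : (Rabs x + Rabs y) ^ m <= (2 * Rmax (Rabs x) (Rabs y)) ^ m).
  { apply pow_incr. assert (H1 := Rmax_l (Rabs x) (Rabs y)).
    assert (H2 := Rmax_r (Rabs x) (Rabs y)). lra. }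
  rewrite Rpow_mult_distr in H.
  apply Rle_trans with (1 := H), Rmult_le_compat_l; [assumption|].
  destruct (Rmax_case_strong (Rabs x) (Rabs y) (fun z => z ^ m <= Rabs x ^ m + Rabs y ^ m)); try lra.
  all: unfold Rmax; destruct (Rle_dec (Rabs x) (Rabs y)); lra.
Qed.

Lemma pow_even_sum_le (x y : R) (j : nat) :
  (x + y) ^ (2 * j + 2) <= 2 ^ (2 * j + 2) * (x ^ (2 * j + 2) + y ^ (2 * j + 2)).
Proof.
  rewrite <- (pow_abs_even (x + y)), <- (pow_abs_even x), <- (pow_abs_even y).
  apply Rle_trans with (2 := pow_sum_le x y _).
  apply pow_incr. split; [apply Rabs_pos | apply Rabs_triang].
Qed.

(* The source of the decoupling of [u^+] and [u^-]: their increments never have opposite signs. *)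
Lemma pow_even_same_sign (x y : R) (j : nat) : 0 <= x * y ->
  x ^ (2 * j + 2) <= (x + y) ^ (2 * j + 1) * x.
Proof.
  intros H. replace (2 * j + 2)%nat with (2 * j + 1 + 1)%nat by lia.
  rewrite !pow_add, !pow_1, !pow_mult.
  assert (P : (x ^ 2) ^ j <= ((x + y) ^ 2) ^ j).
  { apply pow_incr. nra. }
  assert (P0 : 0 <= (x ^ 2) ^ j) by apply pow_le, pow2_ge_0.
  rewrite !Rmult_assoc. apply Rmult_le_compat; nra.
Qed.

(** The one-sided inequalities for [x] and for [y] are added: their last factors sum to [x + y]. *)
Lemma pow_even_superadd (x y : R) (j : nat) : 0 <= x * y ->
  x ^ (2 * j + 2) + y ^ (2 * j + 2) <= (x + y) ^ (2 * j + 2).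
Proof.
  intros H. assert (H1 := pow_even_same_sign x y j H).
  assert (H2 := pow_even_same_sign y x j ltac:(lra)).
  rewrite (Rplus_comm y x) in H2.
  replace ((x + y) ^ (2 * j + 2)) with ((x + y) ^ (2 * j + 1) * (x + y)); [lra|].
  replace (2 * j + 2)%nat with (S (2 * j + 1)) by lia. simpl. lra.
Qed.

(* Average the inequalities given by the tangent line of [exp] at [lam z], taken at [z] and at [0]. *)
Lemma exp_weighted_am_gm (lam z : R) : 0 <= lam <= 1 ->
  exp (lam * z) <= lam * exp z + (1 - lam).
Proof.
  intros Hl. set (e := exp (lam * z)). assert (He : 0 < e) by apply exp_pos.
  assert (H1 : e * (1 + (1 - lam) * z) <= exp z).
  { replace z with (lam * z + (1 - lam) * z) at 2 by lra. rewrite exp_plus.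
    apply Rmult_le_compat_l; [unfold e in He; lra | apply exp_ineq1_le]. }
  assert (H2 : e * (1 + - (lam * z)) <= 1).
  { replace 1 with (exp (lam * z) * exp (- (lam * z))) at 2
      by (rewrite <- exp_plus, Rplus_opp_r; apply exp_0).
    apply Rmult_le_compat_l; [unfold e in He; lra | apply exp_ineq1_le]. }
  nra.
Qed.

Lemma exp_mul_1_sub_le (s : R) : exp s * (1 - s) <= 1.
Proof.
  assert (H := exp_ineq1_le (- s)). assert (P := exp_pos s).
  replace 1 with (exp s * exp (- s)) at 2 by (rewrite <- exp_plus, Rplus_opp_r; apply exp_0).
  apply Rmult_le_compat_l; lra.
Qed.

(* With [d = q - p] and [A = r sum c |u|^q], the equation is [e^(-q y) <I'(e^y u), e^y u> = 0]. *)
Lemma fibre_root (N L A d : R) : 0 < d -> 0 <= N -> 0 < A ->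
  exists y, N * exp (- (d * y)) - L - A * y = 0 /\ Rabs y <= Rabs (N - L) / A /\
            (N <= L -> y <= 0).
Proof.
  intros Hd HN HA.
  set (f := fun y => N * exp (- (d * y)) - L - A * y).
  set (Y := Rabs (N - L) / A).
  assert (HAY : A * Y = Rabs (N - L)) by (unfold Y; field; lra).
  assert (HY : 0 <= Y) by (apply Rdiv_le_0_compat; [apply Rabs_pos | assumption]).
  assert (Habs := Rle_abs (N - L)).
  assert (Habs' := Rle_abs (- (N - L))). rewrite Rabs_Ropp in Habs'.
  assert (Hexp : forall y, 0 <= y -> exp (- (d * y)) <= 1 /\ 1 <= exp (- (d * - y))).
  { intros y Hy. split.
    - rewrite <- exp_0. apply Rnot_lt_le. intros H. apply exp_lt_inv in H. nra.
    - rewrite <- exp_0. apply Rnot_lt_le. intros H. apply exp_lt_inv in H. nra. }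
  (* At [Y] the linear term outweighs [N - L], and the exponential factor only helps; symmetrically
     at [- Y]. *)
  assert (Hf1 : f Y <= 0).
  { unfold f. destruct (Hexp Y HY) as [H _]. nra. }
  assert (Hf2 : 0 <= f (- Y)).
  { unfold f. destruct (Hexp Y HY) as [_ H]. nra. }
  destruct (IVT_gen f (- Y) Y 0) as [y [Hy Hy0]].
  - intros y. apply continuity_pt_filterlim.
    apply (ex_derive_continuous f). unfold f. auto_derive. exact I.
  - rewrite Rmin_right, Rmax_left by lra. lra.
  - rewrite Rmin_left, Rmax_right in Hy by lra.
    exists y. split; [exact Hy0|]. split.
    + apply Rabs_le. exact Hy.
    (* A positive root is impossible when [N <= L]: there the exponential is at most 1 and [- A * y]
       is negative. *)
    + intros HNL. apply Rnot_lt_le. intros Hpos.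
      destruct (Hexp y ltac:(lra)) as [H _]. unfold f in Hy0. nra.
Qed.
(** * Extraction of subsequences *)

Lemma is_lim_seq_pow (x : nat -> R) (l : R) (n : nat) :
  is_lim_seq x l -> is_lim_seq (fun k => x k ^ n) (l ^ n).
Proof.
  apply (is_lim_seq_continuous (fun y => y ^ n)).
  apply derivable_continuous_pt, derivable_pt_pow.
Qed.

Lemma is_lim_seq_inv_INR_S : is_lim_seq (fun k => / INR (S k)) 0.
Proof.
  replace (Finite 0) with (Rbar_inv p_infty) by reflexivity.
  apply is_lim_seq_inv; [|discriminate].
  apply (is_lim_seq_incr_1 INR), is_lim_seq_INR.
Qed.

Lemma inv_INR_S_pos (k : nat) : 0 < / INR (S k).
Proof. apply Rinv_0_lt_compat, lt_0_INR. lia. Qed.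

Lemma inv_INR_S_le_1 (k : nat) : / INR (S k) <= 1.
Proof.
  rewrite <- Rinv_1. apply Rinv_le_contravar; [lra|]. apply (le_INR 1). lia.
Qed.

(** Only [k <= sg k] is demanded of an extraction; this already carries limits, and a cluster point
    yields it with tolerance [1 / (k + 1)]. *)
Lemma bounded_cvg_subseq (x : nat -> R) (B : R) :
  (forall k, Rabs (x k) <= B) ->
  exists sg : nat -> nat, (forall k, (k <= sg k)%nat) /\
    exists l : R, is_lim_seq (fun k => x (sg k)) l.
Proof.
  intros HB.
  destruct (Bolzano_Weierstrass x (fun y => - B <= y <= B)) as [l Hl].
  - apply compact_P3.
  - intros k. apply Rabs_le_between, HB.
  - destruct (choice (fun k p => (k <= p)%nat /\ Rabs (x p - l) < / INR (S k))) as [sg Hsg].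
    { intros k. assert (Hk := inv_INR_S_pos k).
      destruct (Hl (disc l (mkposreal _ Hk)) k) as [p [Hp1 Hp2]].
      - exists (mkposreal _ Hk). intros y Hy; exact Hy.
      - exists p. split; assumption. }
    exists sg. split; [intros k; apply Hsg|]. exists l.
    apply is_lim_seq_ext with (u := fun k => (x (sg k) - l) + l); [intros; lra|].
    replace (Finite l) with (Finite (0 + l)) by (f_equal; lra).
    apply is_lim_seq_plus'; [|apply is_lim_seq_const].
    apply is_lim_seq_abs_0.
    apply is_lim_seq_le_le with (u := fun _ => 0) (w := fun k => / INR (S k)).
    + intros k. split; [apply Rabs_pos | left; apply Hsg].
    + apply is_lim_seq_const.
    + apply is_lim_seq_inv_INR_S.
Qed.

(** The shift [i] serves the diagonal argument: the diagonal runs inside the [i]-th extraction only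
    from position [i] on, with a lag of at most [i]. *)
Lemma is_lim_seq_reindex (x : nat -> R) (sg : nat -> nat) (l : R) (i : nat) :
  (forall k, (i <= k)%nat -> (k - i <= sg k)%nat) -> is_lim_seq x l ->
  is_lim_seq (fun k => x (sg k)) l.
Proof.
  intros Hsg Hx. apply is_lim_seq_subseq with (2 := Hx).
  intros P [N HN]. exists (N + i)%nat. intros k Hk. apply HN.
  specialize (Hsg k ltac:(lia)). lia.
Qed.

Lemma diagonal_subseq (x : nat -> nat -> R) (B : R) :
  (forall k i, Rabs (x k i) <= B) ->
  exists sg : nat -> nat, (forall k, (k <= sg k)%nat) /\
    forall i, exists l : R, is_lim_seq (fun k => x (sg k) i) l.
Proof.
  intros HB.
  (* One extraction is chosen for every sequence at once; sequences not bounded by [B] get one as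
     well, so that the recursion below is total. *)
  destruct (choice (fun (y : nat -> R) (sg : nat -> nat) => (forall k, (k <= sg k)%nat) /\
     ((forall k, Rabs (y k) <= B) -> exists l : R, is_lim_seq (fun k => y (sg k)) l)))
    as [S HS].
  { intros y. destruct (Classical_Prop.classic (forall k, Rabs (y k) <= B)) as [H|H].
    - destruct (bounded_cvg_subseq y B H) as [sg [H1 H2]]. exists sg. tauto.
    - exists (fun k => k). split; [intros; lia | tauto]. }
  (* [Phi i] refines [Phi (i - 1)] so that coordinate [i] converges too. *)
  set (Phi := fix Phi i := match i with
    | O => S (fun k => x k O)
    | Datatypes.S i' => fun k => Phi i' (S (fun k => x (Phi i' k) i) k)
    end).
  assert (HPhi : forall i k, (k <= Phi i k)%nat).
  { induction i as [|i IH]; intros k; simpl.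
    - apply HS.
    - eapply Nat.le_trans; [|apply IH]. apply HS. }
  assert (Hlim : forall i, exists l : R, is_lim_seq (fun k => x (Phi i k) i) l).
  { intros [|i]; simpl.
    - destruct (HS (fun k => x k O)) as [_ H]. apply H. intros k; apply HB.
    - destruct (HS (fun k => x (Phi i k) (Datatypes.S i))) as [_ H]. apply H.
      intros k; apply HB. }
  assert (Hsub : forall i d, exists tau : nat -> nat, (forall k, (k <= tau k)%nat) /\
            forall k, Phi (d + i)%nat k = Phi i (tau k)).
  { intros i. induction d as [|d [tau [H1 H2]]].
    - exists (fun k => k). split; [intros; lia | reflexivity].
    - simpl. set (y := fun k => x (Phi (d + i)%nat k) (Datatypes.S (d + i))).
      exists (fun k => tau (S y k)). split.
      + intros k. eapply Nat.le_trans; [|apply H1]. apply (HS y).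
      + intros k. apply H2. }
  exists (fun k => Phi k k). split; [intros k; apply HPhi|].
  intros i. destruct (Hlim i) as [l Hl]. exists l.
  (* [t k] is the place of the diagonal index [Phi k k] within [Phi i]; for [k < i] it is
     unconstrained. *)
  destruct (choice (fun k t => (i <= k)%nat -> (k - i <= t)%nat /\ Phi k k = Phi i t))
    as [t Ht].
  { intros k. destruct (le_lt_dec i k) as [Hk|Hk].
    - destruct (Hsub i (k - i)%nat) as [tau [H1 H2]].
      exists (tau k). intros _. split.
      + specialize (H1 k). lia.
      + rewrite <- H2. f_equal. lia.
    - exists O. lia. }
  apply is_lim_seq_ext_loc with (u := fun k => x (Phi i (t k)) i).
  - exists i. intros k Hk. now rewrite (proj2 (Ht k Hk)).
  - apply (is_lim_seq_reindex (fun k => x (Phi i k) i) t l i); [|assumption].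
    intros k Hk. apply Ht, Hk.
Qed.

(** The nonnegative indices are treated first; a second extraction from that subsequence handles the
    others. *)
Lemma diagonal_subseqZ (x : nat -> Z -> R) (B : R) :
  (forall k n, Rabs (x k n) <= B) ->
  exists (sg : nat -> nat) (l : Z -> R), (forall k, (k <= sg k)%nat) /\
    forall n, is_lim_seq (fun k => x (sg k) n) (l n).
Proof.
  intros HB.
  destruct (diagonal_subseq (fun k i => x k (Z.of_nat i)) B) as [s1 [H1 L1]]; [auto|].
  destruct (diagonal_subseq (fun k i => x (s1 k) (- Z.of_nat i)%Z) B) as [s2 [H2 L2]]; [auto|].
  exists (fun k => s1 (s2 k)).
  destruct (choice (fun (n : Z) (l : R) => is_lim_seq (fun k => x (s1 (s2 k)) n) l)) as [l Hl].
  { intros n. destruct (Z_le_gt_dec 0 n) as [Hn|Hn].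
    - destruct (L1 (Z.to_nat n)) as [l Hl]. rewrite Z2Nat.id in Hl by lia.
      exists l. apply (is_lim_seq_reindex (fun k => x (s1 k) n) s2 l O); [|assumption].
      intros k _. specialize (H2 k). lia.
    - destruct (L2 (Z.to_nat (- n))) as [l Hl]. rewrite Z2Nat.id in Hl by lia.
      rewrite Z.opp_involutive in Hl. now exists l. }
  exists l. split; [|assumption].
  intros k. specialize (H1 (s2 k)). specialize (H2 k). lia.
Qed.

(** The mean value point satisfies [|xi| <= |x| + |y|] because [s <= 1], so the bound does not
    depend on [s] and can serve as a majorant. *)
Lemma pow_difference_quotient_bound (x y s : R) (m : nat) : 0 < s <= 1 ->
  Rabs (((x + s * y) ^ S m - x ^ S m) / s)
  <= INR (S m) * 2 ^ S m * (Rabs x ^ S m + Rabs y ^ S m).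
Proof.
  intros Hs.
  destruct (increment_mean_value (fun z => z ^ S m) (fun z => INR (S m) * 1 * z ^ m) x (s * y))
    as [xi [Hxi1 Hxi2]].
  { intros z. apply (is_derive_pow (fun z => z) (S m) z 1). exact (is_derive_id z). }
  rewrite Hxi1.
  replace (INR (S m) * 1 * xi ^ m * (s * y) / s) with (INR (S m) * (xi ^ m * y)) by (field; lra).
  assert (HI : 0 <= INR (S m)) by apply pos_INR.
  rewrite Rabs_mult, (Rabs_pos_eq (INR (S m))), Rmult_assoc by assumption.
  apply Rmult_le_compat_l; [assumption|].
  apply Rle_trans with (2 := pow_sum_le x y (S m)).
  rewrite Rabs_mult, <- RPow_abs.
  assert (Hx := Rabs_pos x). assert (Hy := Rabs_pos y).
  assert (Hxi : Rabs xi <= Rabs x + Rabs y).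
  { replace xi with ((xi - x) + x) by lra.
    eapply Rle_trans; [apply Rabs_triang|].
    rewrite Rabs_mult, (Rabs_pos_eq s) in Hxi2 by lra. nra. }
  assert (P := pow_incr (Rabs xi) (Rabs x + Rabs y) m ltac:(split; [apply Rabs_pos | assumption])).
  assert (P0 := pow_le _ m (Rabs_pos xi)).
  simpl. rewrite Rmult_comm. apply Rmult_le_compat; lra.
Qed.

(** * The Nehari set *)

(** An exponential factor keeps the dilation positive and makes its effect on logarithms an additive
    shift by [y]. *)
Definition dilate (y : R) (u : Z -> R) (n : Z) : R := exp y * u n.

Section Nehari.

Variables (j : nat) (q r b0 : R) (a b c : Z -> R).
Local Notation p := (INR (2 * j + 2)).
Local Notation m := (2 * j + 2)%nat.
Hypotheses (Hq : p < q) (Hr : 0 < r) (Ha : forall n, 0 < a n)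
  (Hb0 : 0 < b0) (Hb : forall n, b0 <= b n)
  (Hc : forall n, 0 < c n) (Hcs : ex_seriesZ c).

Local Notation E := (inE p a b).
Local Notation D := (inD p q r a b c).
Local Notation N := (normp p a b).
Local Notation A u := (sumZ (fun n => c n * pw (Rabs (u n)) q)).
Local Notation L u := (sumZ (logterm q r c u)).
Local Notation I := (Ifun p q r a b c).
Local Notation dI := (dI p q r a b c).
Local Notation inN := (inN p q r a b c).
Local Notation inM := (inM p q r a b c).

(** * The norm functional and the space [E] *)

Lemma two_le_p : 2 <= p.
Proof. rewrite plus_INR, mult_INR. simpl. assert (H := pos_INR j). lra. Qed.

Lemma normterm_pow (u : Z -> R) (n : Z) :
  normterm p a b u n = a n * Dlt u n ^ m + b n * u n ^ m.
Proof. unfold normterm. now rewrite !pw_abs_even. Qed.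

Lemma normterm_nonneg (u : Z -> R) (n : Z) : 0 <= normterm p a b u n.
Proof.
  rewrite normterm_pow. assert (H1 := sqr_pow_nonneg (Dlt u n) j).
  assert (H2 := sqr_pow_nonneg (u n) j). specialize (Ha n). specialize (Hb n). nra.
Qed.

Lemma normp_nonneg (u : Z -> R) : E u -> 0 <= N u.
Proof. intros H. apply sumZ_nonneg; [apply normterm_nonneg | exact H]. Qed.

Lemma pow_le_normp (u : Z -> R) (n : Z) : E u -> b0 * u n ^ m <= N u.
Proof.
  intros H. apply Rle_trans with (normterm p a b u n).
  - rewrite normterm_pow. assert (H1 := sqr_pow_nonneg (Dlt u n) j).
    assert (H2 := sqr_pow_nonneg (u n) j). specialize (Ha n). specialize (Hb n). nra.
  - exact (term_le_sumZ _ n (normterm_nonneg u) H).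
Qed.

(** A linear bound in [N u] replaces the [p]-th root: if [|u n| > 1], then
    [|u n| <= |u n|^p <= N u / b0]. *)
Lemma abs_le_normp (u : Z -> R) (n : Z) : E u -> Rabs (u n) <= 1 + N u / b0.
Proof.
  intros H. assert (H1 := pow_le_normp u n H). assert (H0 := normp_nonneg u H).
  assert (H2 : u n ^ m <= N u / b0).
  { apply Rmult_le_reg_l with b0; [assumption|].
    replace (b0 * (N u / b0)) with (N u) by (field; lra). exact H1. }
  rewrite <- pow_abs_even in H2.
  destruct (Rle_lt_dec (Rabs (u n)) 1) as [H3|H3].
  - assert (0 <= N u / b0) by (apply Rdiv_le_0_compat; assumption). lra.
  - rewrite pow_even_succ in H2.
    assert (H4 := pow_R1_Rle (Rabs (u n)) (2 * j + 1) ltac:(lra)).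
    assert (Rabs (u n) * 1 <= Rabs (u n) * Rabs (u n) ^ (2 * j + 1))
      by (apply Rmult_le_compat_l; [apply Rabs_pos | exact H4]).
    lra.
Qed.

Lemma inE_ext (u v : Z -> R) : (forall n, u n = v n) -> E u -> E v.
Proof.
  intros H. apply ex_seriesZ_ext. intros n. unfold normterm, Dlt. now rewrite !H.
Qed.

Lemma inE_lin (u v : Z -> R) (x y : R) : E u -> E v -> E (fun n => x * u n + y * v n).
Proof.
  intros Hu Hv.
  apply ex_seriesZ_le with (g := fun n => 2 ^ m * (x ^ m * normterm p a b u n
                                                   + y ^ m * normterm p a b v n)).
  - intros n. rewrite Rabs_pos_eq by apply normterm_nonneg. rewrite !normterm_pow.
    assert (H1 := pow_even_sum_le (x * u n) (y * v n) j).
    assert (H2 := pow_even_sum_le (x * Dlt u n) (y * Dlt v n) j).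
    rewrite !Rpow_mult_distr in H1, H2.
    replace (Dlt (fun n => x * u n + y * v n) n) with (x * Dlt u n + y * Dlt v n)
      by (unfold Dlt; lra).
    assert (Hbn : 0 <= b n) by (specialize (Hb n); lra).
    apply Rmult_le_compat_l with (1 := Hbn) in H1.
    apply Rmult_le_compat_l with (1 := Rlt_le _ _ (Ha n)) in H2. lra.
  - apply ex_seriesZ_scal, ex_seriesZ_plus; apply ex_seriesZ_scal; assumption.
Qed.

(** * Series weighted by [c] *)

Lemma ex_seriesZ_weight (g : Z -> R) (C : R) :
  (forall n, Rabs (g n) <= C) -> ex_seriesZ (fun n => c n * g n).
Proof.
  intros H. apply ex_seriesZ_le with (g := fun n => C * c n).
  - intros n. rewrite Rabs_mult, (Rabs_pos_eq (c n)) by (left; apply Hc).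
    rewrite Rmult_comm. apply Rmult_le_compat_r; [left; apply Hc | apply H].
  - now apply ex_seriesZ_scal.
Qed.

Lemma ex_seriesZ_weight_comp (f : R -> R) (u : Z -> R) :
  (forall x, continuity_pt f x) -> E u -> ex_seriesZ (fun n => c n * f (u n)).
Proof.
  intros Hf Hu. destruct (continuity_pt_bounded f (1 + N u / b0) Hf) as [C [_ HC]].
  apply (ex_seriesZ_weight (fun n => f (u n)) C).
  intros n. apply HC. now apply abs_le_normp.
Qed.

(** The bound [B] keeps all values in a compact interval, where [|f| <= C]; then [C * c n] is a
    summable majorant. *)
Lemma is_lim_seq_weight_comp (f : R -> R) (u : nat -> Z -> R) (l : Z -> R) (B : R) :
  (forall x, continuity_pt f x) -> (forall k n, Rabs (u k n) <= B) ->
  (forall n, is_lim_seq (fun k => u k n) (l n)) ->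
  is_lim_seq (fun k => sumZ (fun n => c n * f (u k n))) (sumZ (fun n => c n * f (l n))).
Proof.
  intros Hf HB Hl. destruct (continuity_pt_bounded f B Hf) as [C [_ HC]].
  apply (sumZ_dominated (fun k n => c n * f (u k n)) _ (fun n => C * c n)).
  - intros k n. rewrite Rabs_mult, (Rabs_pos_eq (c n)) by (left; apply Hc).
    rewrite Rmult_comm. apply Rmult_le_compat_r; [left; apply Hc | now apply HC].
  - now apply ex_seriesZ_scal.
  - intros n. apply is_lim_seq_mult'; [apply is_lim_seq_const|].
    apply is_lim_seq_continuous; auto.
Qed.

Lemma continuity_pw_q (x : R) : continuity_pt (fun x => pw (Rabs x) q) x.
Proof. apply continuity_pt_pw_abs. assert (H := two_le_p). lra. Qed.

Lemma continuity_rpowlog (x : R) : continuity_pt (fun x => r * powlog q x) x.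
Proof.
  apply (continuity_pt_scal (powlog q)). apply continuity_pt_powlog.
  assert (H := two_le_p). lra.
Qed.

Lemma continuity_logpot' (x : R) : continuity_pt (fun x => - r * (powlog (q - 2) x * x)) x.
Proof.
  apply (continuity_pt_scal (fun x => powlog (q - 2) x * x)).
  apply (continuity_pt_mult (powlog (q - 2)) (fun x => x)); [|apply continuity_pt_id].
  apply continuity_pt_powlog. assert (H := two_le_p). lra.
Qed.

Lemma logterm_powlog (u : Z -> R) (n : Z) : logterm q r c u n = c n * (r * powlog q (u n)).
Proof.
  unfold logterm. destruct (Req_EM_T (u n) 0) as [->|H].
  - rewrite powlog_0. lra.
  - rewrite ln_Rpower. unfold powlog. lra.
Qed.

Lemma logsum_powlog (u : Z -> R) : L u = sumZ (fun n => c n * (r * powlog q (u n))).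
Proof. apply sumZ_ext, logterm_powlog. Qed.

Lemma ex_seriesZ_logterm (u : Z -> R) : E u -> ex_seriesZ (logterm q r c u).
Proof.
  intros H. eapply ex_seriesZ_ext.
  - intros n. symmetry. apply logterm_powlog.
  - exact (ex_seriesZ_weight_comp _ u continuity_rpowlog H).
Qed.

Lemma ex_seriesZ_pw_q (u : Z -> R) : E u -> ex_seriesZ (fun n => c n * pw (Rabs (u n)) q).
Proof. exact (ex_seriesZ_weight_comp _ u continuity_pw_q). Qed.

(** The values of [u] stay in a compact interval, where the logarithmic nonlinearity is bounded;
    summability of [c] does the rest. *)
Lemma inE_inD (u : Z -> R) : E u -> D u.
Proof.
  intros H. split; [exact H|].
  apply ex_seriesZ_ext with (f := fun n => c n * Rabs (r * powlog q (u n))).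
  - intros n. now rewrite logterm_powlog, (Rabs_mult (c n)), (Rabs_pos_eq (c n))
      by (left; apply Hc).
  - apply (ex_seriesZ_weight_comp (fun x => Rabs (r * powlog q x)) u); [|assumption].
    intros x. apply (continuity_pt_comp (fun x => r * powlog q x) Rabs).
    + apply continuity_rpowlog.
    + apply Rcontinuity_abs.
Qed.

Lemma weight_sum_pos (u : Z -> R) : E u -> Defs.nonzero u -> 0 < A u.
Proof.
  intros Hu [n Hn].
  assert (H : c n * pw (Rabs (u n)) q <= A u).
  { apply (term_le_sumZ (fun n => c n * pw (Rabs (u n)) q)).
    - intros i. apply Rmult_le_pos; [left; apply Hc | apply pw_nonneg].
    - now apply ex_seriesZ_pw_q. }
  apply Rlt_le_trans with (2 := H).
  apply Rmult_lt_0_compat; [apply Hc|]. rewrite pw_pos by now apply Rabs_pos_lt.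
  apply exp_pos.
Qed.

Lemma weight_sum_nonneg (u : Z -> R) : E u -> 0 <= A u.
Proof.
  intros Hu. apply sumZ_nonneg; [|now apply ex_seriesZ_pw_q].
  intros i. apply Rmult_le_pos; [left; apply Hc | apply pw_nonneg].
Qed.

Lemma nonzero_of_weight_sum_pos (u : Z -> R) : 0 < A u -> Defs.nonzero u.
Proof.
  intros H. apply Classical_Prop.NNPP. intros Hn.
  rewrite (sumZ_ext _ (fun n => 0 * c n)), sumZ_scal in H; [lra|].
  intros n. destruct (Req_dec (u n) 0) as [->|Hu].
  - rewrite Rabs_R0, pw_0. lra.
  - exfalso. apply Hn. now exists n.
Qed.

Lemma normp_pos (u : Z -> R) : E u -> Defs.nonzero u -> 0 < N u.
Proof.
  intros Hu [n Hn]. apply Rlt_le_trans with (2 := pow_le_normp u n Hu).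
  apply Rmult_lt_0_compat; [assumption|].
  rewrite <- pow_abs_even. apply pow_lt, Rabs_pos_lt, Hn.
Qed.

(** * The derivative and two forms of the energy *)

Lemma dI_split (u v : Z -> R) : dI u v
  = sumZ (fun n => a n * Dlt u n ^ (2 * j + 1) * Dlt v n + b n * u n ^ (2 * j + 1) * v n)
    + sumZ (fun n => c n * (- r * (powlog (q - 2) (u n) * u n) * v n)).
Proof.
  unfold Defs.dI. unfold Rminus. f_equal.
  - apply sumZ_ext. intros n. now rewrite !phi_even.
  (* The sign moves inside the second sum, whose summand becomes [c n] times the derivative of
     [logpot] at [u n] times [v n]. *)
  - rewrite <- (Rmult_1_l (sumZ _)), Ropp_mult_distr_l, <- sumZ_scal.
    apply sumZ_ext. intros n. destruct (Req_EM_T (u n) 0) as [->|H].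
    + lra.
    + rewrite ln_Rpower. unfold powlog. lra.
Qed.

(** A Young inequality bounds each mixed term by the norm terms of [u] and [v]. *)
Lemma ex_seriesZ_dI_norm (u v : Z -> R) : E u -> E v ->
  ex_seriesZ (fun n => a n * Dlt u n ^ (2 * j + 1) * Dlt v n + b n * u n ^ (2 * j + 1) * v n).
Proof.
  intros Hu Hv.
  apply ex_seriesZ_le with (g := fun n => normterm p a b u n + normterm p a b v n).
  - intros n. rewrite !normterm_pow. eapply Rle_trans; [apply Rabs_triang|].
    assert (Hbn : 0 <= b n) by (specialize (Hb n); lra).
    rewrite !Rmult_assoc, !(Rabs_mult (a n)), !(Rabs_mult (b n)), !Rabs_mult, <- !RPow_abs.
    rewrite (Rabs_pos_eq (a n)) by (left; apply Ha).
    rewrite (Rabs_pos_eq (b n)) by assumption.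
    assert (H1 := young_pow (Dlt u n) (Dlt v n) (2 * j + 1)).
    assert (H2 := young_pow (u n) (v n) (2 * j + 1)).
    replace (S (2 * j + 1)) with m in H1, H2 by lia.
    rewrite !pow_abs_even in H1, H2.
    apply Rmult_le_compat_l with (1 := Hbn) in H2.
    apply Rmult_le_compat_l with (1 := Rlt_le _ _ (Ha n)) in H1. lra.
  - now apply ex_seriesZ_plus.
Qed.

Lemma ex_seriesZ_dI_log (u v : Z -> R) : E u -> E v ->
  ex_seriesZ (fun n => c n * (- r * (powlog (q - 2) (u n) * u n) * v n)).
Proof.
  intros Hu Hv.
  destruct (continuity_pt_bounded _ (1 + N u / b0) continuity_logpot') as [C [HC0 HC]].
  apply (ex_seriesZ_weight _ (C * (1 + N v / b0))).
  intros n. rewrite Rabs_mult. apply Rmult_le_compat; try apply Rabs_pos.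
  - apply HC. now apply abs_le_normp.
  - now apply abs_le_normp.
Qed.

Lemma dI_plus (u v w : Z -> R) : E u -> E v -> E w ->
  dI u (fun n => v n + w n) = dI u v + dI u w.
Proof.
  intros Hu Hv Hw. rewrite !dI_split.
  rewrite (sumZ_ext _ (fun n => (a n * Dlt u n ^ (2 * j + 1) * Dlt v n + b n * u n ^ (2 * j + 1) * v n)
    + (a n * Dlt u n ^ (2 * j + 1) * Dlt w n + b n * u n ^ (2 * j + 1) * w n)))
    by (intros n; unfold Dlt; lra).
  rewrite (sumZ_ext (fun n => c n * (- r * (powlog (q - 2) (u n) * u n) * (v n + w n)))
    (fun n => c n * (- r * (powlog (q - 2) (u n) * u n) * v n)
    + c n * (- r * (powlog (q - 2) (u n) * u n) * w n))) by (intros n; lra).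
  rewrite (sumZ_plus _ _ (ex_seriesZ_dI_norm u v Hu Hv) (ex_seriesZ_dI_norm u w Hu Hw)).
  rewrite (sumZ_plus _ _ (ex_seriesZ_dI_log u v Hu Hv) (ex_seriesZ_dI_log u w Hu Hw)).
  lra.
Qed.

Lemma dI_opp (u v : Z -> R) : dI u (fun n => (- 1) * v n) = - dI u v.
Proof.
  rewrite !dI_split.
  rewrite (sumZ_ext _ (fun n => (-1) * (a n * Dlt u n ^ (2 * j + 1) * Dlt v n
    + b n * u n ^ (2 * j + 1) * v n))) by (intros n; unfold Dlt; lra).
  rewrite (sumZ_ext (fun n => c n * (- r * (powlog (q - 2) (u n) * u n) * (-1 * v n)))
    (fun n => (-1) * (c n * (- r * (powlog (q - 2) (u n) * u n) * v n)))) by (intros n; lra).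
  rewrite !sumZ_scal. lra.
Qed.

Lemma dI_diag (u : Z -> R) : dI u u = N u - L u.
Proof.
  rewrite dI_split, logsum_powlog. unfold Rminus. f_equal.
  - apply sumZ_ext. intros n. rewrite normterm_pow.
    rewrite !pow_even_succ. lra.
  - rewrite <- (Rmult_1_l (sumZ (fun n => c n * (r * powlog q (u n))))), Ropp_mult_distr_l, <- sumZ_scal.
    apply sumZ_ext. intros n. unfold powlog. rewrite (pw_abs_square q (u n)).
    change (q + - (2)) with (q - 2). lra.
Qed.

(** The last summand is [dI u u / q], which vanishes on the Nehari set and leaves two nonnegative
    terms. *)
Lemma Ifun_split (u : Z -> R) :
  I u = (/ p - / q) * N u + r / q ^ 2 * A u + / q * (N u - L u).
Proof. unfold Ifun. lra. Qed.

Lemma Ifun_logpot (u : Z -> R) : E u ->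
  I u = / p * N u + sumZ (fun n => c n * logpot q r (u n)).
Proof.
  intros Hu. unfold Ifun.
  rewrite (sumZ_ext (fun n => c n * logpot q r (u n))
    (fun n => r / q ^ 2 * (c n * pw (Rabs (u n)) q) - / q * logterm q r c u n)).
  - rewrite sumZ_minus.
    + rewrite !sumZ_scal. lra.
    + now apply ex_seriesZ_scal, ex_seriesZ_pw_q.
    + now apply ex_seriesZ_scal, ex_seriesZ_logterm.
  - intros n. rewrite logterm_powlog. unfold logpot. lra.
Qed.

Lemma inN_iff (u : Z -> R) : inN u <-> E u /\ Defs.nonzero u /\ N u = L u.
Proof.
  unfold Defs.inN. rewrite dI_diag. split.
  - intros [[H1 _] [H2 H3]]. split; [assumption|split; [assumption|lra]].
  - intros [H1 [H2 H3]]. split; [now apply inE_inD|]. split; [assumption|lra].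
Qed.

(** * Dilations and the Nehari set *)

Lemma inE_dilate (y : R) (u : Z -> R) : E u -> E (dilate y u).
Proof.
  intros H. apply inE_ext with (2 := inE_lin u u (exp y) 0 H H).
  intros n. unfold dilate. lra.
Qed.

Lemma nonzero_dilate (y : R) (u : Z -> R) : Defs.nonzero u -> Defs.nonzero (dilate y u).
Proof.
  intros [n Hn]. exists n. unfold dilate. assert (H := exp_pos y).
  apply Rmult_integral_contrapositive_currified; lra.
Qed.

Lemma normp_dilate (y : R) (u : Z -> R) : N (dilate y u) = exp (p * y) * N u.
Proof.
  unfold normp. rewrite <- sumZ_scal. apply sumZ_ext. intros n. unfold normterm.
  replace (Dlt (dilate y u) n) with (exp y * Dlt u n) by (unfold Dlt, dilate; lra).
  unfold dilate. rewrite !pw_exp_scale. lra.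
Qed.

Lemma weight_sum_dilate (y : R) (u : Z -> R) : A (dilate y u) = exp (q * y) * A u.
Proof.
  rewrite <- sumZ_scal. apply sumZ_ext. intros n. unfold dilate.
  rewrite pw_exp_scale. lra.
Qed.

Lemma logsum_dilate (y : R) (u : Z -> R) : E u ->
  L (dilate y u) = exp (q * y) * (L u + r * y * A u).
Proof.
  intros Hu. rewrite !logsum_powlog.
  rewrite <- (sumZ_scal (r * y)), <- sumZ_plus, <- sumZ_scal.
  - apply sumZ_ext. intros n. unfold dilate. rewrite powlog_exp_scale. lra.
  - exact (ex_seriesZ_weight_comp _ u continuity_rpowlog Hu).
  - now apply ex_seriesZ_scal, ex_seriesZ_pw_q.
Qed.

(** This is [fibre_root] with [d = q - p]. The bound on [|y|] makes the dilation nearly trivial when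
    [N u - L u] is small, and the sign condition says that [N u <= L u] calls for shrinking. *)
Lemma nehari_dilation (u : Z -> R) : E u -> Defs.nonzero u ->
  exists y, inN (dilate y u) /\ Rabs y <= Rabs (N u - L u) / (r * A u) /\
            (N u <= L u -> y <= 0).
Proof.
  intros Hu H0. assert (HA := weight_sum_pos u Hu H0).
  destruct (fibre_root (N u) (L u) (r * A u) (q - p)) as [y [Hy1 [Hy2 Hy3]]].
  - lra.
  - now apply normp_nonneg.
  - now apply Rmult_lt_0_compat.
  - exists y. split; [|split; assumption].
    apply inN_iff. split; [now apply inE_dilate|]. split; [now apply nonzero_dilate|].
    rewrite normp_dilate, logsum_dilate by assumption.
    (* Factoring out [exp (q * y)] leaves the equation solved by [fibre_root]. *)
    replace (p * y) with (q * y + - ((q - p) * y)) by lra. rewrite exp_plus.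
    replace (L u) with (N u * exp (- ((q - p) * y)) - r * A u * y) by lra. lra.
Qed.

(** Two independent inequalities: the terms in [N u] compare by the weighted mean inequality with
    weight [p / q], the terms in [A u] by [exp s * (1 - s) <= 1] at [s = q * y]. *)
Lemma nehari_fibre_max (u : Z -> R) (y : R) : inN u -> I (dilate y u) <= I u.
Proof.
  intros H. apply inN_iff in H. destruct H as [Hu [H0 HNL]].
  assert (HN := normp_nonneg u Hu). assert (HA := weight_sum_nonneg u Hu).
  assert (Hp := two_le_p).
  unfold Ifun. fold (L u). fold (L (dilate y u)).
  rewrite normp_dilate, weight_sum_dilate, logsum_dilate by assumption. rewrite <- HNL.
  assert (H1 : exp (p * y) <= p / q * exp (q * y) + (1 - p / q)).
  { replace (p * y) with (p / q * (q * y)) by (field; lra).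
    apply exp_weighted_am_gm. split.
    - apply Rdiv_le_0_compat; lra.
    - apply Rmult_le_reg_r with q; [lra|]. unfold Rdiv.
      rewrite Rmult_assoc, Rinv_l by lra. lra. }
  assert (H2 := exp_mul_1_sub_le (q * y)).
  set (ep := exp (p * y)) in *. set (eq := exp (q * y)) in *.
  assert (H3 : / p * ep <= / q * eq + (/ p - / q)).
  { apply Rmult_le_reg_l with p; [lra|].
    replace (p * (/ p * ep)) with ep by (field; lra).
    replace (p * (/ q * eq + (/ p - / q))) with (p / q * eq + (1 - p / q)) by (field; lra).
    exact H1. }
  assert (H4 : r / q ^ 2 * (eq * (1 - q * y)) <= r / q ^ 2 * 1).
  { apply Rmult_le_compat_l; [|assumption]. apply Rdiv_le_0_compat; [lra|].
    apply pow_lt; lra. }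
  apply Rmult_le_compat_r with (1 := HN) in H3.
  apply Rmult_le_compat_r with (1 := HA) in H4.
  replace (/ p * (ep * N u) + r / q ^ 2 * (eq * A u) - / q * (eq * (N u + r * y * A u)))
    with (/ p * ep * N u - / q * eq * N u + r / q ^ 2 * (eq * (1 - q * y)) * A u)
    by (field; lra).
  lra.
Qed.

Lemma exp_nonpos_le_1 (x : R) : x <= 0 -> exp x <= 1.
Proof.
  intros H. destruct (Req_dec x 0) as [->|Hx]; [rewrite exp_0; lra|].
  left. rewrite <- exp_0. apply exp_increasing. lra.
Qed.

(** Here [y <= 0], so the dilation increases neither [N] nor [A], and on the Nehari set the energy
    is this very combination of them. *)
Lemma nehari_dilation_le (u : Z -> R) : E u -> Defs.nonzero u -> N u <= L u ->
  exists w, inN w /\ I w <= (/ p - / q) * N u + r / q ^ 2 * A u.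
Proof.
  intros Hu H0 HNL. destruct (nehari_dilation u Hu H0) as [y [Hy [_ Hy0]]].
  specialize (Hy0 HNL). exists (dilate y u). split; [assumption|].
  rewrite Ifun_split. apply inN_iff in Hy. destruct Hy as [_ [_ Hy]]. rewrite <- Hy.
  rewrite Rminus_diag, Rmult_0_r, Rplus_0_r.
  rewrite normp_dilate, weight_sum_dilate.
  assert (HN := normp_nonneg u Hu). assert (HA := weight_sum_nonneg u Hu).
  assert (Hp := two_le_p).
  assert (E1 : exp (p * y) <= 1) by (apply exp_nonpos_le_1; nra).
  assert (E2 : exp (q * y) <= 1) by (apply exp_nonpos_le_1; nra).
  assert (P1 : 0 <= / p - / q).
  { assert (/ q < / p) by (apply Rinv_lt_contravar; nra). lra. }
  assert (P2 : 0 <= r / q ^ 2) by (apply Rdiv_le_0_compat; [lra | apply pow_lt; lra]).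
  apply Rplus_le_compat; apply Rmult_le_compat_l; try assumption; nra.
Qed.

(* [N u = L u > 0] forces [|u n| > 1] for some [n]. *)
Lemma nehari_normp_lower (u : Z -> R) : inN u -> b0 <= N u.
Proof.
  intros H. apply inN_iff in H. destruct H as [Hu [H0 HNL]].
  assert (HN := normp_pos u Hu H0).
  destruct (Classical_Prop.classic (exists n, 1 < Rabs (u n))) as [[n Hn]|Hn].
  - apply Rle_trans with (2 := pow_le_normp u n Hu).
    rewrite <- pow_abs_even.
    assert (H1 := pow_R1_Rle (Rabs (u n)) m ltac:(lra)). nra.
  (* If all [|u n| <= 1], every logarithmic term is at most 0, so [L u <= 0 < N u]. *)
  - exfalso. apply (Rlt_irrefl 0). apply Rlt_le_trans with (1 := HN). rewrite HNL.
    rewrite <- (Rmult_0_l (sumZ c)), <- sumZ_scal.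
    apply sumZ_le; [|now apply ex_seriesZ_logterm | now apply ex_seriesZ_scal].
    intros n. rewrite logterm_powlog, Rmult_0_l.
    assert (Hn1 : Rabs (u n) <= 1) by (apply Rnot_lt_le; intros ?; apply Hn; now exists n).
    destruct (Req_dec (u n) 0) as [->|Hun]; [rewrite powlog_0; lra|].
    assert (Hln : ln (Rabs (u n)) <= 0).
    { rewrite <- ln_1. apply ln_le; [now apply Rabs_pos_lt | assumption]. }
    assert (Hpw := pw_nonneg (Rabs (u n)) q). specialize (Hc n).
    unfold powlog.
    assert (0 <= c n * r * pw (Rabs (u n)) q) by (repeat apply Rmult_le_pos; lra). nra.
Qed.

Lemma nehari_energy_lower (u : Z -> R) : inN u -> (/ p - / q) * N u <= I u.
Proof.
  intros H. rewrite Ifun_split. apply inN_iff in H. destruct H as [Hu [H0 HNL]].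
  rewrite <- HNL. assert (HA := weight_sum_nonneg u Hu). assert (Hp := two_le_p).
  assert (P2 : 0 <= r / q ^ 2) by (apply Rdiv_le_0_compat; [lra | apply pow_lt; lra]).
  nra.
Qed.

Lemma inv_p_q_pos : 0 < / p - / q.
Proof.
  assert (Hp := two_le_p).
  assert (/ q < / p) by (apply Rinv_lt_contravar; nra). lra.
Qed.

(** * Existence of a minimizer *)

Lemma nehari_nonempty : exists u, inN u.
Proof.
  set (d := fun n : Z => if Z.eq_dec n 0 then 1 else 0).
  assert (Hd : E d).
  (* The increments of the unit sequence live at [-1] and [0], hence the cutoff [2]. *)
  { apply ex_seriesZ_finite with 2%nat. intros n Hn. rewrite normterm_pow.
    unfold Dlt, d. destruct (Z.eq_dec n 0), (Z.eq_dec (n + 1) 0); try lia.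
    rewrite Rminus_0_r, pow_i by lia. lra. }
  destruct (nehari_dilation d Hd) as [y [Hy _]].
  - exists 0%Z. unfold d. simpl. lra.
  - now exists (dilate y d).
Qed.

Lemma nehari_minimizer : exists u, inN u /\ forall w, inN w -> I u <= I w.
Proof.
  assert (Hpq := inv_p_q_pos).
  assert (Hp := two_le_p).
  (* Energies are negated because [completeness] gives suprema; the infimum is [- M]. *)
  set (vals := fun x => exists u, inN u /\ x = - I u).
  destruct (completeness vals) as [M [HM1 HM2]].
  - exists 0. intros x [u [Hu ->]].
    assert (H1 := nehari_energy_lower u Hu). assert (H2 := nehari_normp_lower u Hu). nra.
  - destruct nehari_nonempty as [u Hu]. now exists (- I u), u.
  - assert (Hinf : forall w, inN w -> - M <= I w).
    { intros w Hw. specialize (HM1 (- I w)). enough (- I w <= M) by lra.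
      apply HM1. now exists w. }
    (* A minimizing sequence: without it [M - 1 / (k + 1)] would already bound [vals] for some
       [k]. *)
    destruct (choice (fun (k : nat) u => inN u /\ I u <= - M + / INR (S k))) as [u Hu].
    { intros k. apply Classical_Prop.NNPP. intros Hn.
      assert (Hk := inv_INR_S_pos k).
      assert (M <= M - / INR (S k)); [|lra].
      apply HM2. intros x [w [Hw ->]]. apply Rnot_lt_le. intros Hlt. apply Hn.
      exists w. split; [assumption|lra]. }
    assert (HI : is_lim_seq (fun k => I (u k)) (- M)).
    { apply is_lim_seq_le_le with (u := fun _ => - M) (w := fun k => - M + / INR (S k)).
      - intros k. split; [apply Hinf|]; apply Hu.
      - apply is_lim_seq_const.
      - replace (Finite (- M)) with (Finite (- M + 0)) by (f_equal; lra).
        apply is_lim_seq_plus'; [apply is_lim_seq_const | apply is_lim_seq_inv_INR_S]. }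
    assert (HNb : forall k, N (u k) <= (- M + 1) / (/ p - / q)).
    { intros k. destruct (Hu k) as [Hk1 Hk2].
      assert (H1 := nehari_energy_lower _ Hk1).
      assert (Hk := inv_INR_S_le_1 k).
      apply Rmult_le_reg_l with (/ p - / q); [assumption|].
      replace ((/ p - / q) * ((- M + 1) / (/ p - / q))) with (- M + 1) by (field; lra).
      lra. }
    set (B := 1 + (- M + 1) / (/ p - / q) / b0).
    assert (HB : forall k n, Rabs (u k n) <= B).
    { intros k n. destruct (Hu k) as [Hk1 _]. apply inN_iff in Hk1.
      apply Rle_trans with (1 := abs_le_normp (u k) n (proj1 Hk1)).
      unfold B. apply Rplus_le_compat_l. apply Rmult_le_compat_r.
      - left. now apply Rinv_0_lt_compat.
      - apply HNb. }
    destruct (diagonal_subseqZ u B HB) as [sg [l [Hsg Hl]]].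
    assert (HA : is_lim_seq (fun k => A (u (sg k))) (A l)).
    { exact (is_lim_seq_weight_comp _ (fun k => u (sg k)) l B continuity_pw_q
               (fun k => HB _) Hl). }
    (* On the Nehari set [N] equals [L], so convergence of the logarithmic sums gives that of the
       norms. *)
    assert (HL : is_lim_seq (fun k => N (u (sg k))) (L l)).
    { rewrite logsum_powlog.
      apply is_lim_seq_ext with (u := fun k => sumZ (fun n => c n * (r * powlog q (u (sg k) n)))).
      - intros k. rewrite <- logsum_powlog. symmetry.
        destruct (Hu (sg k)) as [Hk1 _]. apply inN_iff in Hk1. apply Hk1.
      - exact (is_lim_seq_weight_comp _ (fun k => u (sg k)) l B continuity_rpowlog
               (fun k => HB _) Hl). }
    assert (HIs : is_lim_seq (fun k => I (u (sg k))) (- M)).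
    { apply (is_lim_seq_reindex (fun k => I (u k)) sg (- M) O); [|assumption].
      intros k _. specialize (Hsg k). lia. }
    (* Fatou yields [l] in [E] with [N l <= L l]: norm may be lost in the limit, which the dilation
       below corrects. *)
    destruct (sumZ_fatou (fun k => normterm p a b (u (sg k))) (normterm p a b l)
                (fun k => N (u (sg k))) (L l)) as [HE HNL].
    + intros k n. apply normterm_nonneg.
    + intros k. destruct (Hu (sg k)) as [Hk1 _]. apply inN_iff in Hk1. apply Hk1.
    + intros n. rewrite normterm_pow.
      apply is_lim_seq_ext with
        (u := fun k => a n * Dlt (u (sg k)) n ^ m + b n * u (sg k) n ^ m).
      { intros k. now rewrite normterm_pow. }
      apply is_lim_seq_plus'; apply is_lim_seq_mult'; try apply is_lim_seq_const;
        apply is_lim_seq_pow; [apply is_lim_seq_minus'|]; apply Hl.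
    + intros k. apply Rle_refl.
    + assumption.
    (* The uniform lower bound on [N] passes to [L l] and excludes [l = 0]. *)
    + assert (HLb : b0 <= L l).
      { apply (is_lim_seq_le (fun _ => b0) (fun k => N (u (sg k))) b0 (L l)).
        - intros k. apply nehari_normp_lower, Hu.
        - apply is_lim_seq_const.
        - assumption. }
      assert (Hl0 : Defs.nonzero l).
      { apply Classical_Prop.NNPP. intros Hn.
        rewrite logsum_powlog, (sumZ_ext _ (fun n => 0 * c n)), sumZ_scal in HLb; [lra|].
        intros n. destruct (Req_dec (l n) 0) as [->|Hln].
        - rewrite powlog_0. lra.
        - exfalso. apply Hn. now exists n. }
      destruct (nehari_dilation_le l HE Hl0 HNL) as [w [Hw1 Hw2]].
      exists w. split; [assumption|]. intros w' Hw'.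
      apply Rle_trans with (2 := Hinf w' Hw'). apply Rle_trans with (1 := Hw2).
      apply Rle_trans with ((/ p - / q) * L l + r / q ^ 2 * A l).
      { apply Rplus_le_compat_r, Rmult_le_compat_l; [lra | exact HNL]. }
      (* The energies of the sequence, expressed through [N] and [A], converge both to this value
         and to [- M]. *)
      right. enough (Finite ((/ p - / q) * L l + r / q ^ 2 * A l) = Finite (- M)) as HF
        by now injection HF.
      rewrite <- (is_lim_seq_unique _ _ HIs). symmetry. apply is_lim_seq_unique.
      apply is_lim_seq_ext with
        (u := fun k => (/ p - / q) * N (u (sg k)) + r / q ^ 2 * A (u (sg k))).
      * intros k. rewrite Ifun_split. destruct (Hu (sg k)) as [Hk1 _].
        apply inN_iff in Hk1. destruct Hk1 as [_ [_ Hk1]]. rewrite <- Hk1. lra.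
      * apply is_lim_seq_plus'; apply is_lim_seq_mult'; try apply is_lim_seq_const; assumption.
Qed.

(** * Minimizers are critical points *)

Lemma nehari_near (u v : Z -> R) (eps : R) : inN u -> E v -> 0 < eps ->
  exists s y, 0 < s <= 1 /\ s <= eps /\ Rabs y <= eps /\
              inN (dilate y (fun n => u n + s * v n)).
Proof.
  intros HuN Hv Heps. destruct (proj1 (inN_iff u) HuN) as [Hu [Hu0 HNL]].
  set (s := fun k => / INR (S k)).
  set (w := fun k n => u n + s k * v n).
  assert (Hs0 : forall k, 0 < s k) by apply inv_INR_S_pos.
  assert (Hs1 : forall k, s k <= 1) by apply inv_INR_S_le_1.
  assert (Hw : forall k, E (w k)).
  { intros k. apply inE_ext with (2 := inE_lin u v 1 (s k) Hu Hv).
    intros n. unfold w. lra. }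
  assert (Hlim : forall n, is_lim_seq (fun k => w k n) (u n)).
  { intros n. unfold w. replace (Finite (u n)) with (Finite (u n + 0 * v n)) by (f_equal; lra).
    apply is_lim_seq_plus'; [apply is_lim_seq_const|].
    apply is_lim_seq_mult'; [apply is_lim_seq_inv_INR_S | apply is_lim_seq_const]. }
  assert (HB : forall k n, Rabs (w k n) <= (1 + N u / b0) + (1 + N v / b0)).
  { intros k n. unfold w. eapply Rle_trans; [apply Rabs_triang|].
    apply Rplus_le_compat; [now apply abs_le_normp|].
    rewrite Rabs_mult, (Rabs_pos_eq (s k)) by (left; apply Hs0).
    assert (H := abs_le_normp v n Hv). assert (H' := Rabs_pos (v n)).
    specialize (Hs0 k). specialize (Hs1 k). nra. }
  assert (HA : is_lim_seq (fun k => A (w k)) (A u))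
    by exact (is_lim_seq_weight_comp _ w u _ continuity_pw_q HB Hlim).
  assert (HL : is_lim_seq (fun k => L (w k)) (L u)).
  { rewrite logsum_powlog. eapply is_lim_seq_ext.
    - intros k. symmetry. apply logsum_powlog.
    - exact (is_lim_seq_weight_comp _ w u _ continuity_rpowlog HB Hlim). }
  assert (HN : is_lim_seq (fun k => N (w k)) (N u)).
  { apply (sumZ_dominated (fun k => normterm p a b (w k)) (normterm p a b u)
             (fun n => 2 ^ m * (normterm p a b u n + normterm p a b v n))).
    - intros k n. rewrite Rabs_pos_eq by apply normterm_nonneg. rewrite !normterm_pow.
      assert (Hpow : forall x y, (x + s k * y) ^ m <= 2 ^ m * (x ^ m + y ^ m)).
      { intros x y. eapply Rle_trans; [apply pow_even_sum_le|].
        apply Rmult_le_compat_l; [apply pow_le; lra|].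
        apply Rplus_le_compat_l. rewrite Rpow_mult_distr.
        assert (H1 : s k ^ m <= 1 ^ m) by (apply pow_incr; split; [left; apply Hs0 | apply Hs1]).
        rewrite pow1 in H1. assert (H2 := sqr_pow_nonneg y j).
        apply Rmult_le_compat_r with (1 := H2) in H1. lra. }
      replace (Dlt (w k) n) with (Dlt u n + s k * Dlt v n) by (unfold Dlt, w; lra).
      assert (H1 := Hpow (Dlt u n) (Dlt v n)). assert (H2 := Hpow (u n) (v n)).
      assert (Hbn : 0 <= b n) by (specialize (Hb n); lra).
      apply Rmult_le_compat_l with (1 := Hbn) in H2.
      apply Rmult_le_compat_l with (1 := Rlt_le _ _ (Ha n)) in H1.
      unfold w at 1. lra.
    - now apply ex_seriesZ_scal, ex_seriesZ_plus.
    - intros n. rewrite normterm_pow. eapply is_lim_seq_ext.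
      + intros k. symmetry. apply normterm_pow.
      + apply is_lim_seq_plus'; apply is_lim_seq_mult'; try apply is_lim_seq_const;
          apply is_lim_seq_pow; [apply is_lim_seq_minus'|]; apply Hlim. }
  assert (HAu := weight_sum_pos u Hu Hu0).
  (* The numerator tends to [|N u - L u| = 0] and the denominator to [r * A u > 0]; this quotient
     bounds the dilation exponent. *)
  assert (Hquot : is_lim_seq (fun k => Rabs (N (w k) - L (w k)) / (r * A (w k))) 0).
  { replace (Finite 0) with (Finite (Rabs (N u - L u) / (r * A u)))
      by (f_equal; rewrite HNL, Rminus_diag, Rabs_R0; unfold Rdiv; lra).
    apply is_lim_seq_div'.
    - apply (is_lim_seq_abs _ (N u - L u)). now apply is_lim_seq_minus'.
    - apply is_lim_seq_mult'; [apply is_lim_seq_const | assumption].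
    - apply Rgt_not_eq. now apply Rmult_lt_0_compat. }
  (* Tolerance [A u] keeps [A (w k)] positive, so that [w k] is nonzero. *)
  destruct (proj2 (is_lim_seq_spec _ _) HA (mkposreal _ HAu)) as [K1 HK1].
  destruct (proj2 (is_lim_seq_spec _ _) Hquot (mkposreal _ Heps)) as [K2 HK2].
  destruct (proj2 (is_lim_seq_spec _ _) is_lim_seq_inv_INR_S (mkposreal _ Heps)) as [K3 HK3].
  set (k := (K1 + K2 + K3)%nat).
  specialize (HK1 k ltac:(lia)). specialize (HK2 k ltac:(lia)). specialize (HK3 k ltac:(lia)).
  cbn [pos] in HK1, HK2, HK3. rewrite Rminus_0_r in HK2, HK3.
  apply Rabs_lt_between in HK1.
  assert (HAk : 0 < A (w k)) by lra.
  destruct (nehari_dilation (w k) (Hw k) (nonzero_of_weight_sum_pos _ HAk)) as [y [Hy1 [Hy2 _]]].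
  exists (s k), y. split; [split; auto|]. split; [|split].
  - apply Rle_trans with (1 := Rle_abs _). left. exact HK3.
  - apply Rle_trans with (1 := Hy2). apply Rle_trans with (1 := Rle_abs _). left. exact HK2.
  - exact Hy1.
Qed.

(** Dominated convergence for the norm part. Base point [t u] and direction [t v] both vary, since
    the perturbed function is dilated back to the Nehari set; the majorant absorbs this through the
    factor [T ^ m]. *)
Lemma is_lim_seq_norm_quotient (u v : Z -> R) (s t : nat -> R) (T : R) :
  E u -> E v -> (forall k, 0 < s k <= 1) -> is_lim_seq s 0 ->
  (forall k, 0 <= t k <= T) -> is_lim_seq t 1 ->
  is_lim_seq (fun k => (N (fun n => t k * u n + s k * (t k * v n))
                        - N (fun n => t k * u n)) / s k)
    (p * sumZ (fun n => a n * Dlt u n ^ (2 * j + 1) * Dlt v n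
                        + b n * u n ^ (2 * j + 1) * v n)).
Proof.
  intros Hu Hv Hs Hs0 Ht Ht1.
  set (Q := fun x y k => ((t k * x + s k * (t k * y)) ^ m - (t k * x) ^ m) / s k).
  assert (Hq1 : forall x y, is_lim_seq (Q x y) (p * x ^ (2 * j + 1) * y)).
  { intros x y. unfold Q.
    apply (is_lim_seq_difference_quotient (fun z => z ^ m) (fun z => p * z ^ (2 * j + 1))).
    - intros z. replace (p * z ^ (2 * j + 1)) with (p * 1 * z ^ pred m)
        by (replace (pred m) with (2 * j + 1)%nat by lia; lra).
      apply (is_derive_pow (fun z => z) m z 1). exact (is_derive_id z).
    - apply (continuity_pt_scal (fun z => z ^ (2 * j + 1))).
      apply derivable_continuous_pt, derivable_pt_pow.
    - replace (Finite x) with (Finite (1 * x)) by (f_equal; lra).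
      apply is_lim_seq_mult'; [assumption | apply is_lim_seq_const].
    - replace (Finite y) with (Finite (1 * y)) by (f_equal; lra).
      apply is_lim_seq_mult'; [assumption | apply is_lim_seq_const].
    - assumption.
    - intros k. specialize (Hs k). lra. }
  set (C := p * 2 ^ m * T ^ m).
  assert (Hq2 : forall x y k, Rabs (Q x y k) <= C * (x ^ m + y ^ m)).
  { intros x y k. unfold Q, C.
    assert (H := pow_difference_quotient_bound (t k * x) (t k * y) (s k) (2 * j + 1) (Hs k)).
    replace (S (2 * j + 1)) with m in H by lia.
    apply Rle_trans with (1 := H). rewrite !pow_abs_even, !Rpow_mult_distr.
    rewrite !Rmult_assoc. apply Rmult_le_compat_l; [apply pos_INR|].
    apply Rmult_le_compat_l; [apply pow_le; lra|].
    rewrite <- Rmult_plus_distr_l. apply Rmult_le_compat_r.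
    - assert (H1 := sqr_pow_nonneg x j). assert (H2 := sqr_pow_nonneg y j). lra.
    - apply pow_incr, Ht. }
  assert (HE1 : forall k, E (fun n => t k * u n + s k * (t k * v n))).
  { intros k. apply inE_ext with (2 := inE_lin u v (t k) (s k * t k) Hu Hv).
    intros n. lra. }
  assert (HE2 : forall k, E (fun n => t k * u n)).
  { intros k. apply inE_ext with (2 := inE_lin u u (t k) 0 Hu Hu).
    intros n. lra. }
  rewrite <- sumZ_scal.
  apply is_lim_seq_ext with (u := fun k => sumZ (fun n =>
    a n * Q (Dlt u n) (Dlt v n) k + b n * Q (u n) (v n) k)).
  { intros k. unfold normp. rewrite <- (sumZ_minus _ _ (HE1 k) (HE2 k)).
    unfold Rdiv. rewrite Rmult_comm, <- sumZ_scal. apply sumZ_ext. intros n.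
    rewrite !normterm_pow.
    replace (Dlt (fun n => t k * u n + s k * (t k * v n)) n)
      with (t k * Dlt u n + s k * (t k * Dlt v n)) by (unfold Dlt; lra).
    replace (Dlt (fun n => t k * u n) n) with (t k * Dlt u n) by (unfold Dlt; lra).
    unfold Q, Rdiv. lra. }
  apply (sumZ_dominated _ _ (fun n => C * (normterm p a b u n + normterm p a b v n))).
  - intros k n. rewrite !normterm_pow. eapply Rle_trans; [apply Rabs_triang|].
    assert (Hbn : 0 <= b n) by (specialize (Hb n); lra).
    rewrite !Rabs_mult, (Rabs_pos_eq (a n)), (Rabs_pos_eq (b n))
      by (assumption || (left; apply Ha)).
    assert (H1 := Hq2 (Dlt u n) (Dlt v n) k). assert (H2 := Hq2 (u n) (v n) k).
    apply Rmult_le_compat_l with (1 := Hbn) in H2.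
    apply Rmult_le_compat_l with (1 := Rlt_le _ _ (Ha n)) in H1. lra.
  - now apply ex_seriesZ_scal, ex_seriesZ_plus.
  - intros n.
    replace (p * (a n * Dlt u n ^ (2 * j + 1) * Dlt v n + b n * u n ^ (2 * j + 1) * v n))
      with (a n * (p * Dlt u n ^ (2 * j + 1) * Dlt v n) + b n * (p * u n ^ (2 * j + 1) * v n))
      by lra.
    apply is_lim_seq_plus'; apply is_lim_seq_mult'; try apply is_lim_seq_const; apply Hq1.
Qed.

(** Here the majorant comes from the mean value theorem: the derivative of [logpot] is bounded on
    the interval of radius [T * Bu + T * Bv], which contains all intermediate points. *)
Lemma is_lim_seq_logpot_quotient (u v : Z -> R) (s t : nat -> R) (T : R) :
  E u -> E v -> (forall k, 0 < s k <= 1) -> is_lim_seq s 0 ->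
  (forall k, 0 <= t k <= T) -> is_lim_seq t 1 ->
  is_lim_seq (fun k => (sumZ (fun n => c n * logpot q r (t k * u n + s k * (t k * v n)))
                        - sumZ (fun n => c n * logpot q r (t k * u n))) / s k)
    (sumZ (fun n => c n * (- r * (powlog (q - 2) (u n) * u n) * v n))).
Proof.
  intros Hu Hv Hs Hs0 Ht Ht1. assert (Hp := two_le_p).
  set (f' := fun x => - r * (powlog (q - 2) x * x)).
  assert (Hf : forall x, is_derive (logpot q r) x (f' x)).
  { intros x. apply is_derive_logpot. lra. }
  assert (Hfc : forall x, continuity_pt (logpot q r) x).
  { intros x. apply continuity_pt_filterlim.
    apply (ex_derive_continuous (logpot q r)). eexists. apply Hf. }
  set (Bu := 1 + N u / b0). set (Bv := 1 + N v / b0).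
  assert (HBu : forall n, Rabs (u n) <= Bu) by (intros n; now apply abs_le_normp).
  assert (HBv : forall n, Rabs (v n) <= Bv) by (intros n; now apply abs_le_normp).
  assert (HT : 0 <= T) by (specialize (Ht O); lra).
  assert (Hsc : forall k x B, Rabs x <= B -> Rabs (t k * x) <= T * B).
  { intros k x B HB. specialize (Ht k).
    rewrite Rabs_mult, (Rabs_pos_eq (t k)) by lra.
    apply Rmult_le_compat; try lra. apply Rabs_pos. }
  destruct (continuity_pt_bounded f' (T * Bu + T * Bv) continuity_logpot') as [C [HC0 HC]].
  set (Q := fun x y k => (logpot q r (t k * x + s k * (t k * y)) - logpot q r (t k * x)) / s k).
  assert (Hsv : forall k n, Rabs (s k * (t k * v n)) <= T * Bv).
  { intros k n. specialize (Hs k). rewrite Rabs_mult, (Rabs_pos_eq (s k)) by lra.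
    assert (H := Hsc k (v n) Bv (HBv n)). assert (H' := Rabs_pos (t k * v n)). nra. }
  assert (HQ : forall k n, Rabs (Q (u n) (v n) k) <= C * (T * Bv)).
  { intros k n. unfold Q.
    destruct (increment_mean_value (logpot q r) f' (t k * u n) (s k * (t k * v n)) Hf)
      as [xi [Hxi1 Hxi2]].
    rewrite Hxi1.
    replace (f' xi * (s k * (t k * v n)) / s k) with (f' xi * (t k * v n))
      by (field; specialize (Hs k); lra).
    rewrite Rabs_mult. apply Rmult_le_compat; try apply Rabs_pos.
    - apply HC. replace xi with (t k * u n + (xi - t k * u n)) by lra.
      eapply Rle_trans; [apply Rabs_triang|].
      apply Rplus_le_compat; [now apply Hsc|].
      now apply Rle_trans with (1 := Hxi2).
    - now apply Hsc. }
  apply is_lim_seq_ext with (u := fun k => sumZ (fun n => c n * Q (u n) (v n) k)).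
  { intros k. rewrite <- sumZ_minus.
    - unfold Rdiv. rewrite Rmult_comm, <- sumZ_scal. apply sumZ_ext. intros n.
      unfold Q, Rdiv. lra.
    - destruct (continuity_pt_bounded (logpot q r) (T * Bu + T * Bv) Hfc) as [C' [_ HC']].
      apply (ex_seriesZ_weight _ C'). intros n. apply HC'.
      eapply Rle_trans; [apply Rabs_triang|]. apply Rplus_le_compat; auto.
    - destruct (continuity_pt_bounded (logpot q r) (T * Bu) Hfc) as [C' [_ HC']].
      apply (ex_seriesZ_weight _ C'). intros n. apply HC'. auto. }
  apply (sumZ_dominated _ _ (fun n => C * (T * Bv) * c n)).
  - intros k n. rewrite Rabs_mult, (Rabs_pos_eq (c n)) by (left; apply Hc).
    rewrite Rmult_comm. apply Rmult_le_compat_r; [left; apply Hc | apply HQ].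
  - now apply ex_seriesZ_scal.
  - intros n. apply is_lim_seq_mult'; [apply is_lim_seq_const|].
    apply (is_lim_seq_difference_quotient (logpot q r) f'); try assumption.
    + apply continuity_logpot'.
    + replace (Finite (u n)) with (Finite (1 * u n)) by (f_equal; lra).
      apply is_lim_seq_mult'; [assumption | apply is_lim_seq_const].
    + replace (Finite (v n)) with (Finite (1 * v n)) by (f_equal; lra).
      apply is_lim_seq_mult'; [assumption | apply is_lim_seq_const].
    + intros k. specialize (Hs k). lra.
Qed.

(* With [t (u + s v)] on the Nehari set, [I (t u) <= I u <= I (t (u + s v))]:
   the difference quotients of [I] at [t u] along [t v] are nonnegative. *)
Lemma nehari_minimizer_dI_nonneg (u v : Z -> R) :
  inN u -> (forall w, inN w -> I u <= I w) -> E v -> 0 <= dI u v.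
Proof.
  intros HuN Hmin Hv. destruct (proj1 (inN_iff u) HuN) as [Hu [Hu0 HNL]].
  assert (Hp := two_le_p).
  (* Tolerance [1 / (k + 1)] forces both [s -> 0] and [t = exp y -> 1]. *)
  destruct (choice (fun (k : nat) (sy : R * R) =>
      0 < fst sy <= 1 /\ fst sy <= / INR (S k) /\ Rabs (snd sy) <= / INR (S k) /\
      inN (dilate (snd sy) (fun n => u n + fst sy * v n)))) as [sy Hsy].
  { intros k.
    destruct (nehari_near u v _ HuN Hv (inv_INR_S_pos k)) as [s [y Hs]].
    exists (s, y). exact Hs. }
  set (s := fun k => fst (sy k)). set (t := fun k => exp (snd (sy k))).
  assert (Hs : forall k, 0 < s k <= 1) by (intros k; apply Hsy).
  assert (Hs0 : is_lim_seq s 0).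
  { apply is_lim_seq_le_le with (u := fun _ => 0) (w := fun k => / INR (S k)).
    - intros k. split; [left; apply Hs | apply Hsy].
    - apply is_lim_seq_const.
    - apply is_lim_seq_inv_INR_S. }
  assert (Ht : forall k, 0 <= t k <= exp 1).
  { intros k. split; [left; apply exp_pos|]. unfold t.
    assert (H1 := inv_INR_S_le_1 k). destruct (Hsy k) as [_ [_ [H2 _]]].
    assert (H3 := Rle_abs (snd (sy k))).
    destruct (Req_dec (snd (sy k)) 1) as [->|Hne]; [lra|].
    left. apply exp_increasing. lra. }
  assert (Ht1 : is_lim_seq t 1).
  { rewrite <- exp_0. apply (is_lim_seq_continuous exp).
    - apply derivable_continuous_pt, derivable_pt_exp.
    - apply is_lim_seq_abs_0.
      apply is_lim_seq_le_le with (u := fun _ => 0) (w := fun k => / INR (S k)).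
      + intros k. split; [apply Rabs_pos | apply Hsy].
      + apply is_lim_seq_const.
      + apply is_lim_seq_inv_INR_S. }
  assert (H1 := is_lim_seq_norm_quotient u v s t _ Hu Hv Hs Hs0 Ht Ht1).
  assert (H2 := is_lim_seq_logpot_quotient u v s t _ Hu Hv Hs Hs0 Ht Ht1).
  assert (H3 := is_lim_seq_plus' _ _ _ _ (is_lim_seq_mult' _ _ _ _ (is_lim_seq_const (/ p)) H1) H2).
  (* The factor [/ p] cancels the [p] produced by differentiating the [p]-th power, so the limit is
     [dI u v]. *)
  rewrite <- Rmult_assoc, Rinv_l, Rmult_1_l, <- dI_split in H3 by lra.
  apply (is_lim_seq_le (fun _ => 0) _ 0 (dI u v)) with (3 := H3); [|apply is_lim_seq_const].
  intros k. destruct (Hsy k) as [_ [_ [_ Hk]]].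
  set (z := fun n => t k * u n + s k * (t k * v n)).
  assert (Hz : forall n, dilate (snd (sy k)) (fun n => u n + fst (sy k) * v n) n = z n).
  { intros n. unfold dilate, z, s, t. lra. }
  assert (Hle : I (dilate (snd (sy k)) u) <= I (dilate (snd (sy k)) (fun n => u n + fst (sy k) * v n))).
  { apply Rle_trans with (1 := nehari_fibre_max u _ HuN). now apply Hmin. }
  rewrite !Ifun_logpot in Hle.
  - rewrite (sumZ_ext (fun n => c n * logpot q r (dilate _ (fun n0 => u n0 + _ * v n0) n))
      (fun n => c n * logpot q r (z n))) in Hle by (intros n; now rewrite Hz).
    assert (HNz : N (dilate (snd (sy k)) (fun n => u n + fst (sy k) * v n)) = N z).
    { apply sumZ_ext. intros n. unfold normterm, Dlt. now rewrite !Hz. }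
    rewrite HNz in Hle.
    change (dilate (snd (sy k)) u) with (fun n => t k * u n) in Hle. fold z.
    replace (/ p * ((N z - N (fun n => t k * u n)) / s k)
       + (sumZ (fun n => c n * logpot q r (t k * u n + s k * (t k * v n)))
          - sumZ (fun n => c n * logpot q r (t k * u n))) / s k)
      with ((/ p * N z + sumZ (fun n => c n * logpot q r (z n))
             - (/ p * N (fun n => t k * u n) + sumZ (fun n => c n * logpot q r (t k * u n)))) / s k).
    + apply Rdiv_le_0_compat; [|apply Hs]. cbv beta in Hle. lra.
    + unfold z. field. specialize (Hs k). lra.
  - now apply inN_iff in Hk.
  - now apply inE_dilate.
Qed.

(** Nonnegativity holds in the directions [v] and [- v], and [dI u] is odd in the direction. *)
Lemma nehari_minimizer_critical (u : Z -> R) :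
  inN u -> (forall w, inN w -> I u <= I w) -> critical p q r a b c u.
Proof.
  intros HuN Hmin. split; [apply HuN|].
  intros v [Hv _].
  assert (Hv' : E (fun n => (- 1) * v n)).
  { apply inE_ext with (2 := inE_lin v v (- 1) 0 Hv Hv).
    intros n. lra. }
  assert (H1 := nehari_minimizer_dI_nonneg u v HuN Hmin Hv).
  assert (H2 := nehari_minimizer_dI_nonneg u _ HuN Hmin Hv').
  rewrite dI_opp in H2. lra.
Qed.

(** * Sign-changing functions *)

Lemma sign_part (u w z : Z -> R) : E u -> (forall n, u n = w n + z n) ->
  (forall n, w n * z n = 0) -> (forall n, 0 <= Dlt w n * Dlt z n) ->
  E w /\ N w - L w <= dI u w.
Proof.
  intros Hu Huwz Hwz HD.
  assert (HDu : forall n, Dlt u n = Dlt w n + Dlt z n)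
    by (intros n; unfold Dlt; rewrite !Huwz; lra).
  assert (Hw : E w).
  { apply ex_seriesZ_le with (2 := Hu). intros n.
    rewrite Rabs_pos_eq by apply normterm_nonneg.
    rewrite !normterm_pow, HDu, Huwz.
    assert (H1 := pow_even_superadd (Dlt w n) (Dlt z n) j (HD n)).
    assert (H2 := pow_even_superadd (w n) (z n) j ltac:(rewrite Hwz; lra)).
    assert (P1 := sqr_pow_nonneg (Dlt z n) j). assert (P2 := sqr_pow_nonneg (z n) j).
    specialize (Ha n). specialize (Hb n). apply Rplus_le_compat; apply Rmult_le_compat_l; lra. }
  split; [assumption|]. rewrite dI_split, logsum_powlog. apply Rplus_le_compat.
  (* Increments without opposite signs give [(Dlt w)^p <= (Dlt u)^(p-1) * Dlt w]; this is only an
     inequality, because increments couple the two parts where the sign changes. *)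
  - apply sumZ_le; [|exact Hw | now apply ex_seriesZ_dI_norm].
    intros n. rewrite normterm_pow, HDu, Huwz.
    assert (H1 := pow_even_same_sign (Dlt w n) (Dlt z n) j (HD n)).
    assert (H2 := pow_even_same_sign (w n) (z n) j ltac:(rewrite Hwz; lra)).
    rewrite !Rmult_assoc. specialize (Ha n). specialize (Hb n).
    apply Rplus_le_compat; apply Rmult_le_compat_l; lra.
  - rewrite <- (Rmult_1_l (sumZ (fun n => c n * (r * powlog q (w n))))), Ropp_mult_distr_l,
      <- sumZ_scal.
    right. apply sumZ_ext. intros n.
    (* Where [w n] is nonzero, [z n = 0] and [u n = w n], so the logarithmic sums agree exactly. *)
    destruct (Rmult_integral _ _ (Hwz n)) as [H0|H0].
    + rewrite H0, powlog_0. lra.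
    + rewrite Huwz, H0, Rplus_0_r. unfold powlog. rewrite (pw_abs_square q (w n)). lra.
Qed.

Lemma posp_negp_sum (u : Z -> R) (n : Z) : u n = posp u n + negp u n.
Proof. unfold posp, negp, Rmax, Rmin. destruct (Rle_dec (u n) 0); lra. Qed.

Lemma posp_negp_mult (u : Z -> R) (n : Z) : posp u n * negp u n = 0.
Proof. unfold posp, negp, Rmax, Rmin. destruct (Rle_dec (u n) 0); lra. Qed.

(** Both truncations are nondecreasing functions of the value, so each increment vanishes or has the
    sign of [Dlt u n]. *)
Lemma Dlt_posp_negp (u : Z -> R) (n : Z) : 0 <= Dlt (posp u) n * Dlt (negp u) n.
Proof.
  unfold Dlt, posp, negp, Rmax, Rmin.
  destruct (Rle_dec (u n) 0), (Rle_dec (u (n + 1)%Z) 0); nra.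
Qed.

Lemma nodal_energy (e : R) (u : Z -> R) :
  (forall w, inN w -> e <= I w) -> inM u -> 2 * e <= I u.
Proof.
  intros He [[Hu _] [Hp0 [Hn0 [Hdp Hdn]]]].
  destruct (sign_part u (posp u) (negp u) Hu (posp_negp_sum u) (posp_negp_mult u)
              (Dlt_posp_negp u)) as [HEp HNp].
  (* [sign_part] does not distinguish the two parts, so it applies again with the roles
     exchanged. *)
  destruct (sign_part u (negp u) (posp u) Hu) as [HEn HNn].
  { intros n. rewrite Rplus_comm. apply posp_negp_sum. }
  { intros n. rewrite Rmult_comm, posp_negp_mult. reflexivity. }
  { intros n. rewrite Rmult_comm. apply Dlt_posp_negp. }
  destruct (nehari_dilation_le (posp u) HEp Hp0 ltac:(lra)) as [w1 [Hw1 H1]].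
  destruct (nehari_dilation_le (negp u) HEn Hn0 ltac:(lra)) as [w2 [Hw2 H2]].
  assert (He1 := He w1 Hw1). assert (He2 := He w2 Hw2).
  (* The two equations defining [inM] add up, since [dI u] is additive and [u] is the sum of its
     parts. *)
  assert (HNL : N u - L u = 0).
  { rewrite <- dI_diag.
    replace (dI u u) with (dI u (fun n => posp u n + negp u n)).
    - rewrite dI_plus by assumption. lra.
    - rewrite !dI_split. f_equal; apply sumZ_ext; intros n; unfold Dlt;
        now rewrite <- !posp_negp_sum. }
  rewrite Ifun_split, HNL.
  assert (HN : N (posp u) + N (negp u) <= N u).
  { unfold normp. rewrite <- sumZ_plus by assumption.
    apply sumZ_le; [|now apply ex_seriesZ_plus|exact Hu].
    intros n. rewrite !normterm_pow.
    assert (P1 := pow_even_superadd _ _ j (Dlt_posp_negp u n)).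
    assert (P2 := pow_even_superadd (posp u n) (negp u n) j
                    ltac:(rewrite posp_negp_mult; lra)).
    rewrite <- posp_negp_sum in P2.
    replace (Dlt (posp u) n + Dlt (negp u) n) with (Dlt u n) in P1
      by (unfold Dlt; rewrite (posp_negp_sum u n), (posp_negp_sum u (n + 1)); lra).
    assert (Hbn : 0 <= b n) by (specialize (Hb n); lra).
    apply Rmult_le_compat_l with (1 := Hbn) in P2.
    apply Rmult_le_compat_l with (1 := Rlt_le _ _ (Ha n)) in P1. lra. }
  (* At each [n] one of the two parts vanishes, so [A] splits exactly, whereas [N] was only shown
     superadditive. *)
  assert (HA : A (posp u) + A (negp u) = A u).
  { rewrite <- sumZ_plus by (now apply ex_seriesZ_pw_q).
    apply sumZ_ext. intros n. unfold posp, negp, Rmax, Rmin.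
    destruct (Rle_dec (u n) 0); rewrite Rabs_R0, pw_0; lra. }
  rewrite <- HA. assert (Hpq := inv_p_q_pos).
  apply Rmult_le_compat_l with (r := / p - / q) in HN; lra.
Qed.

End Nehari.

Theorem theorem1p2 (p q r : R) (a b c : Z -> R)
  (Hpq : 1 < p < q) (Hp2 : exists k : nat, (1 <= k)%nat /\ p = 2 * INR k)
  (Hr : 1 <= r)
  (Ha : forall n, 0 < a n) (Hb : forall n, 0 < b n) (Hc : forall n, 0 < c n)
  (C1 : exists b0, 0 < b0 /\ (forall n, b0 <= b n) /\
        (forall M, exists N : Z, forall n : Z, (N < Z.abs n)%Z -> M < b n))
  (C2 : exists c0, 0 < c0 /\ (forall n, c n <= c0) /\ ex_seriesZ c) :
  exists ubar : Z -> R,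
    inN p q r a b c ubar /\ critical p q r a b c ubar /\
    (forall u, inN p q r a b c u -> Ifun p q r a b c ubar <= Ifun p q r a b c u) /\
    0 < Ifun p q r a b c ubar /\
    (forall u, inM p q r a b c u -> 2 * Ifun p q r a b c ubar <= Ifun p q r a b c u).
Proof.
  destruct Hp2 as [[|j] [Hk Hp]]; [lia|].
  (* Here [p / 2 = j + 1], the form of the exponent used throughout the section. *)
  assert (Hpj : p = INR (2 * j + 2)).
  { rewrite Hp, S_INR, plus_INR, mult_INR. simpl. lra. }
  clear Hp. subst p. destruct Hpq as [_ Hq].
  destruct C1 as [b0 [Hb0 [Hbb _]]]. destruct C2 as [_ [_ [_ Hcs]]].
  assert (Hr0 : 0 < r) by lra.
  destruct (nehari_minimizer j q r b0 a b c Hq Hr0 Ha Hb0 Hbb Hc Hcs) as [u [Hu Hmin]].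
  exists u. split; [assumption|]. split; [|split; [assumption|split]].
  - now apply (nehari_minimizer_critical j q r b0).
  (* On the Nehari set the energy is at least [(/ p - / q) * b0], which is positive. *)
  - apply Rlt_le_trans with (2 := nehari_energy_lower j q r b0 a b c Hq Hr0 Ha Hb0 Hbb Hc Hcs u Hu).
    apply Rmult_lt_0_compat.
    + now apply inv_p_q_pos.
    + apply Rlt_le_trans with (1 := Hb0). now apply (nehari_normp_lower j q r b0 a b c).
  - intros w Hw. now apply (nodal_energy j q r b0 a b c).
Qed.
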